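(* Let $\mathbb{X}$ be a semi-abelian category. The following conditions are equivalent: (i) the \emph{Smith is Huq} condition (SH): for every object $X$ of $\mathbb{X}$, any two equivalence relations $R$ and $S$ on $X$ centralise each other as soon as their normalisations Huq-commute in $\mathbb{X}$; (ii) condition (C): any change of base functor with respect to the fibration of points reflects the commutation of normal subobjects; that is, for every morphism $p\colon E\to B$ in $\mathbb{X}$ and every pair of normal subobjects $k$, $l$ of the same object of $\mathrm{Pt}_B(\mathbb{X})$, if $p^*(k)$ and $p^*(l)$ Huq-commute in $\mathrm{Pt}_E(\mathbb{X})$, then $k$ and $l$ Huq-commute in $\mathrm{Pt}_B(\mathbb{X})$; (iii) condition $(\overline{\mathrm{C}})$: any change of base functor with respect to the fibration of points reflects the centralisation of equivalence relations; that is, for every morphism $p\colon E\to B$ in $\mathbb{X}$ and every pair of equivalence relations $R$, $S$ on the same object of $\mathrm{Pt}_B(\mathbb{X})$, if $p^*(R)$ and $p^*(S)$ centralise each other in $\mathrm{Pt}_E(\mathbb{X})$, then $R$ and $S$ centralise each other in $\mathrm{Pt}_B(\mathbb{X})$; (iv) any change of base functor with respect to the basic fibration reflects the centralisation of equivalence relations; that is, for every morphism $p\colon E\to B$ in $\mathbb{X}$ and every pair of equivalence relations $R$, $S$ on the same object of the slice category $(\mathbb{X}\downarrow B)$, if $p^*(R)$ and $p^*(S)$ centralise each other in $(\mathbb{X}\downarrow E)$, then $R$ and $S$ centralise each other in $(\mathbb{X}\downarrow B)$.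
   Context: A semi-abelian category is a pointed, Barr exact, Bourn protomodular category with binary coproducts (in the sense of Janelidze--Márki--Tholen). For an object $B$ of $\mathbb{X}$, $\mathrm{Pt}_B(\mathbb{X})$ is the category of points over $B$: objects are triples $(A,f,r)$ with $f\colon A\to B$, $r\colon B\to A$, $f\circ r=1_B$; morphisms are morphisms in $\mathbb{X}$ compatible with the split epimorphisms to $B$ and their sections. It is pointed, with zero object $(B,1_B,1_B)$. The fibration of points is the functor $\mathrm{Pt}(\mathbb{X})\to\mathbb{X}$ sending a split epimorphism with chosen section to its codomain; its change of base functor along $p\colon E\to B$ is pullback along $p$, $p^*\colon \mathrm{Pt}_B(\mathbb{X})\to\mathrm{Pt}_E(\mathbb{X})$. The basic fibration is the codomain functor $\mathrm{Arr}(\mathbb{X})\to\mathbb{X}$ on the category of arrows; its change of base functor along $p\colon E\to B$ is pullback along $p$, $p^*\colon(\mathbb{X}\downarrow B)\to(\mathbb{X}\downarrow E)$. These functors preserve finite limits, hence send equivalence relations to equivalence relations and normal subobjects to normal subobjects. In a pointed category with finite products, two morphisms $x\colon X\to D$ and $y\colon Y\to D$ Huq-commute (commute) if there is a morphism $\varphi\colon X\times Y\to D$ with $\varphi\circ\langle 1_X,0\rangle=x$ and $\varphi\circ\langle 0,1_Y\rangle=y$. The normalisation of an equivalence relation $R$ on $X$ with projections $r_1,r_2\colon R\to X$ is the monomorphism $r_2\circ\ker(r_1)$; a normal subobject is a normalisation of an equivalence relation (equivalently, here, a kernel). In a Mal'tsev category (finitely complete category in which every reflexive relation is an equivalence relation),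 two equivalence relations $(R,r_1,r_2)$ and $(S,s_1,s_2)$ on an object $X$ centralise each other (commute in the sense of Smith) if there is a morphism $\theta\colon R\times_X S\to X$ (pullback of $r_2$ and $s_1$) such that, in element notation, $\theta(x,y,y)=x$ for all $xRy$, and $\theta(x,x,y)=y$ for all $xSy$, where $(x,y,z)\in R\times_XS$ means $xRy$ and $ySz$. *)

(* Defs.v *)
From Stdlib Require Import ProofIrrelevance Relation_Definitions.

Set Implicit Arguments.
Unset Strict Implicit.

(** * Categories and functors *)

Record Category := {
  Ob :> Type;
  Hom : Ob -> Ob -> Type;
  idm : forall A, Hom A A;
  comp : forall A B C, Hom B C -> Hom A B -> Hom A C;
  comp_id_l : forall A B (f : Hom A B), comp (idm B) f = f;
  comp_id_r : forall A B (f : Hom A B), comp f (idm A) = f;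
  comp_assoc : forall A B C D (h : Hom C D) (g : Hom B C) (f : Hom A B),
    comp h (comp g f) = comp (comp h g) f }.

Arguments Hom {c} A B.
Arguments idm {c} A.
Arguments comp {c A B C} g f.

Declare Scope cat_scope.
Delimit Scope cat_scope with cat.
Notation "g ∘ f" := (comp g f) (at level 40, left associativity) : cat_scope.
Local Open Scope cat_scope.

Record Functor (C D : Category) := {
  fob :> C -> D;
  fmap : forall A B : C, Hom A B -> Hom (fob A) (fob B);
  fmap_id : forall A : C, fmap (idm A) = idm (fob A);
  fmap_comp : forall (A B E : C) (g : Hom B E) (f : Hom A B),
    fmap (g ∘ f) = fmap g ∘ fmap f }.

Arguments fmap {C D} F {A B} f : rename.

Definition is_iso (C : Category) (A B : C) (f : Hom A B) : Prop :=
  exists g : Hom B A, g ∘ f = idm A /\ f ∘ g = idm B.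

Definition reflects_isos (C D : Category) (F : Functor C D) : Prop :=
  forall (A B : C) (f : Hom A B), is_iso (fmap F f) -> is_iso f.

(** * Limits and colimits *)

Section Limits.
Variable C : Category.

Definition is_terminal (T : C) : Prop := forall A : C, exists! f : Hom A T, True.
Definition is_initial (I : C) : Prop := forall A : C, exists! f : Hom I A, True.
Definition is_zero_object (Z : C) : Prop := is_initial Z /\ is_terminal Z.
Definition pointed : Prop := exists Z : C, is_zero_object Z.

Definition is_zero_mor (A B : C) (f : Hom A B) : Prop :=
  exists (Z : C) (g : Hom Z B) (h : Hom A Z), is_zero_object Z /\ f = g ∘ h.

Definition is_product (X Y P : C) (p : Hom P X) (q : Hom P Y) : Prop :=
  forall (T : C) (x : Hom T X) (y : Hom T Y),
    exists! u : Hom T P, p ∘ u = x /\ q ∘ u = y.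

Definition is_coproduct (X Y S : C) (i : Hom X S) (j : Hom Y S) : Prop :=
  forall (T : C) (x : Hom X T) (y : Hom Y T),
    exists! u : Hom S T, u ∘ i = x /\ u ∘ j = y.

Definition has_binary_coproducts : Prop :=
  forall X Y : C, exists (S : C) (i : Hom X S) (j : Hom Y S), is_coproduct i j.

Definition is_pullback (X Y Z : C) (f : Hom X Z) (g : Hom Y Z)
    (P : C) (p : Hom P X) (q : Hom P Y) : Prop :=
  f ∘ p = g ∘ q /\
  forall (T : C) (x : Hom T X) (y : Hom T Y), f ∘ x = g ∘ y ->
    exists! u : Hom T P, p ∘ u = x /\ q ∘ u = y.

Definition is_kernel (A B K : C) (f : Hom A B) (k : Hom K A) : Prop :=
  is_zero_mor (f ∘ k) /\
  forall (T : C) (h : Hom T A), is_zero_mor (f ∘ h) ->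
    exists! u : Hom T K, k ∘ u = h.

Definition is_coequaliser (A B Q : C) (f g : Hom A B) (q : Hom B Q) : Prop :=
  q ∘ f = q ∘ g /\
  forall (T : C) (h : Hom B T), h ∘ f = h ∘ g ->
    exists! u : Hom Q T, u ∘ q = h.

Definition regular_epi (B Q : C) (q : Hom B Q) : Prop :=
  exists (A : C) (f g : Hom A B), is_coequaliser f g q.

Record Pullback (X Y Z : C) (f : Hom X Z) (g : Hom Y Z) := {
  pb : C;
  pb1 : Hom pb X;
  pb2 : Hom pb Y;
  pb_square : f ∘ pb1 = g ∘ pb2;
  pb_lift : forall (T : C) (x : Hom T X) (y : Hom T Y),
    f ∘ x = g ∘ y -> Hom T pb;
  pb1_lift : forall T (x : Hom T X) (y : Hom T Y) (e : f ∘ x = g ∘ y),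
    pb1 ∘ pb_lift e = x;
  pb2_lift : forall T (x : Hom T X) (y : Hom T Y) (e : f ∘ x = g ∘ y),
    pb2 ∘ pb_lift e = y;
  pb_joint_mono : forall T (u v : Hom T pb),
    pb1 ∘ u = pb1 ∘ v -> pb2 ∘ u = pb2 ∘ v -> u = v }.

Lemma Pullback_is_pullback (X Y Z : C) (f : Hom X Z) (g : Hom Y Z)
  (P : Pullback f g) : is_pullback f g (pb1 P) (pb2 P).
Proof.
  split; [apply pb_square|].
  intros T x y e. exists (pb_lift P e). split.
  - split; [apply pb1_lift | apply pb2_lift].
  - intros v [e1 e2]. apply pb_joint_mono.
    + now rewrite e1, pb1_lift.
    + now rewrite e2, pb2_lift.
Qed.

(** Pullbacks are chosen, so that pulling back along a fixed morphism is a
    functor on the nose. *)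
Record FinitelyComplete := {
  fc_terminal : exists T : C, is_terminal T;
  fc_pullback : forall (X Y Z : C) (f : Hom X Z) (g : Hom Y Z), Pullback f g }.

End Limits.

(** * Relations, normality and commutation *)

Section Relations.
Variable C : Category.

(** A pair of parallel morphisms [R ⇉ X]; the relation it represents on
    generalised elements of [X] is [related]. *)
Record Graph (X : C) := {
  gr_ob : C;
  gr1 : Hom gr_ob X;
  gr2 : Hom gr_ob X }.

Definition related (X : C) (R : Graph X) (T : C) (x y : Hom T X) : Prop :=
  exists a : Hom T (gr_ob R), gr1 R ∘ a = x /\ gr2 R ∘ a = y.

Definition jointly_monic (X : C) (R : Graph X) : Prop :=
  forall (T : C) (a b : Hom T (gr_ob R)),
    gr1 R ∘ a = gr1 R ∘ b -> gr2 R ∘ a = gr2 R ∘ b -> a = b.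

Definition equivalence_relation (X : C) (R : Graph X) : Prop :=
  jointly_monic R /\
  forall T : C, equivalence (Hom T X) (fun x y => related R x y).

Definition is_normalisation (X : C) (R : Graph X) (N : C) (n : Hom N X) : Prop :=
  exists k : Hom N (gr_ob R), is_kernel (gr1 R) k /\ n = gr2 R ∘ k.

Definition normal_subobject (X N : C) (n : Hom N X) : Prop :=
  exists R : Graph X, equivalence_relation R /\ is_normalisation R n.

(** [i] and [j] are the morphisms ⟨1,0⟩ and ⟨0,1⟩ into the product. *)
Definition huq_commute (X Y D : C) (x : Hom X D) (y : Hom Y D) : Prop :=
  exists (P : C) (p : Hom P X) (q : Hom P Y) (i : Hom X P) (j : Hom Y P)
         (phi : Hom P D),
    is_product p q /\
    (p ∘ i = idm X /\ is_zero_mor (q ∘ i)) /\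
    (is_zero_mor (p ∘ j) /\ q ∘ j = idm Y) /\
    phi ∘ i = x /\ phi ∘ j = y.

(** A generalised element [u] of [P] is a triple [(x,y,z)] with
    [x = r1 (p u)], [y = r2 (p u) = s1 (q u)] and [z = s2 (q u)]. *)
Definition centralise (X : C) (R S : Graph X) : Prop :=
  exists (P : C) (p : Hom P (gr_ob R)) (q : Hom P (gr_ob S)) (theta : Hom P X),
    is_pullback (gr2 R) (gr1 S) p q /\
    (forall (T : C) (u : Hom T P),
       gr1 S ∘ (q ∘ u) = gr2 S ∘ (q ∘ u) -> theta ∘ u = gr1 R ∘ (p ∘ u)) /\
    (forall (T : C) (u : Hom T P),
       gr1 R ∘ (p ∘ u) = gr2 R ∘ (p ∘ u) -> theta ∘ u = gr2 S ∘ (q ∘ u)).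

End Relations.

Definition graph_image (C D : Category) (F : Functor C D) (X : C) (R : Graph X)
  : Graph (F X) :=
  {| gr_ob := F (gr_ob R); gr1 := fmap F (gr1 R); gr2 := fmap F (gr2 R) |}.

Definition reflects_commutation_of_normal_subobjects
    (C D : Category) (F : Functor C D) : Prop :=
  forall (A K L : C) (k : Hom K A) (l : Hom L A),
    normal_subobject k -> normal_subobject l ->
    huq_commute (fmap F k) (fmap F l) -> huq_commute k l.

Definition reflects_centralisation (C D : Category) (F : Functor C D) : Prop :=
  forall (A : C) (R S : Graph A),
    equivalence_relation R -> equivalence_relation S ->
    centralise (graph_image F R) (graph_image F S) -> centralise R S.

(** * Slices, points and their change of base functors *)

Lemma sig_ext (A : Type) (P : A -> Prop) (x y : sig P) :
  proj1_sig x = proj1_sig y -> x = y.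
Proof.
  destruct x as [x p], y as [y q]; simpl; intro e.
  now apply subset_eq_compat.
Qed.

Section Fibrations.
Variable X : Category.

Section Slice.
Variable B : X.

Record SliceOb := { sl_ob : X; sl_map : Hom sl_ob B }.

Definition SliceHom (A A' : SliceOb) : Type :=
  { h : Hom (sl_ob A) (sl_ob A') | sl_map A' ∘ h = sl_map A }.

Definition slice_id (A : SliceOb) : SliceHom A A :=
  exist _ (idm (sl_ob A)) (comp_id_r (sl_map A)).

Definition slice_comp (A A' A'' : SliceOb) (g : SliceHom A' A'')
  (f : SliceHom A A') : SliceHom A A''.
Proof.
  exists (proj1_sig g ∘ proj1_sig f).
  now rewrite comp_assoc, (proj2_sig g), (proj2_sig f).
Defined.

Definition Slice : Category.
Proof.
  refine {| Ob := SliceOb; Hom := SliceHom;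
            idm := slice_id; comp := slice_comp |};
    intros; apply sig_ext; simpl.
  - apply comp_id_l.
  - apply comp_id_r.
  - apply comp_assoc.
Defined.

Record PointOb := {
  pt_ob : X;
  pt_map : Hom pt_ob B;
  pt_sec : Hom B pt_ob;
  pt_split : pt_map ∘ pt_sec = idm B }.

Definition PointHom (A A' : PointOb) : Type :=
  { h : Hom (pt_ob A) (pt_ob A') |
    pt_map A' ∘ h = pt_map A /\ h ∘ pt_sec A = pt_sec A' }.

Definition point_id (A : PointOb) : PointHom A A :=
  exist _ (idm (pt_ob A)) (conj (comp_id_r (pt_map A)) (comp_id_l (pt_sec A))).

Definition point_comp (A A' A'' : PointOb) (g : PointHom A' A'')
  (f : PointHom A A') : PointHom A A''.
Proof.
  exists (proj1_sig g ∘ proj1_sig f).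
  destruct g as [g [g1 g2]], f as [f [f1 f2]]; simpl; split.
  - now rewrite comp_assoc, g1, f1.
  - now rewrite <- comp_assoc, f2, g2.
Defined.

Definition Points : Category.
Proof.
  refine {| Ob := PointOb; Hom := PointHom;
            idm := point_id; comp := point_comp |};
    intros; apply sig_ext; simpl.
  - apply comp_id_l.
  - apply comp_id_r.
  - apply comp_assoc.
Defined.

Definition zero_point : Points :=
  {| pt_ob := B; pt_map := idm B; pt_sec := idm B;
     pt_split := comp_id_l (idm B) |}.

Lemma zero_point_is_zero : is_zero_object zero_point.
Proof.
  split; intro A.
  - assert (H : pt_map A ∘ pt_sec A = pt_map zero_point
              /\ pt_sec A ∘ pt_sec zero_point = pt_sec A).
    { split; [apply pt_split | apply comp_id_r]. }
    exists (exist _ (pt_sec A) H). split; [exact I|].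
    intros [h [h1 h2]] _. apply sig_ext; simpl in *.
    now rewrite <- h2, comp_id_r.
  - assert (H : pt_map zero_point ∘ pt_map A = pt_map A
              /\ pt_map A ∘ pt_sec A = pt_sec zero_point).
    { split; [apply comp_id_l | apply pt_split]. }
    exists (exist _ (pt_map A) H). split; [exact I|].
    intros [h [h1 h2]] _. apply sig_ext; simpl in *.
    now rewrite <- h1, comp_id_l.
Qed.

End Slice.

Section ChangeOfBase.
Variable L : FinitelyComplete X.
Variables E B : X.
Variable p : Hom E B.

Definition slice_pullback_ob (A : Slice B) : Slice E :=
  {| sl_ob := pb (fc_pullback L p (sl_map A));
     sl_map := pb1 (fc_pullback L p (sl_map A)) |}.

Lemma slice_pullback_eq (A A' : Slice B) (h : Hom A A') :
  p ∘ pb1 (fc_pullback L p (sl_map A))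
  = sl_map A' ∘ (proj1_sig h ∘ pb2 (fc_pullback L p (sl_map A))).
Proof. rewrite comp_assoc, (proj2_sig h). apply pb_square. Qed.

Definition slice_pullback_hom (A A' : Slice B) (h : Hom A A') :
  Hom (slice_pullback_ob A) (slice_pullback_ob A') :=
  exist _ (pb_lift (fc_pullback L p (sl_map A')) (slice_pullback_eq h))
    (pb1_lift _ _).

Definition slice_pullback : Functor (Slice B) (Slice E).
Proof.
  refine {| fob := slice_pullback_ob; fmap := slice_pullback_hom |}.
  - intro A. apply sig_ext; simpl. apply pb_joint_mono.
    + now rewrite pb1_lift, comp_id_r.
    + rewrite pb2_lift; simpl. now rewrite comp_id_l, comp_id_r.
  - intros A A' A'' g f. apply sig_ext; simpl. apply pb_joint_mono.
    + now rewrite comp_assoc, !pb1_lift.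
    + rewrite comp_assoc, !pb2_lift, <- !comp_assoc, pb2_lift.
      simpl. now rewrite comp_assoc.
Defined.

Lemma point_pullback_sec_eq (A : Points B) :
  p ∘ idm E = pt_map A ∘ (pt_sec A ∘ p).
Proof. now rewrite comp_assoc, pt_split, comp_id_l, comp_id_r. Qed.

Definition point_pullback_ob (A : Points B) : Points E :=
  {| pt_ob := pb (fc_pullback L p (pt_map A));
     pt_map := pb1 (fc_pullback L p (pt_map A));
     pt_sec := pb_lift (fc_pullback L p (pt_map A)) (point_pullback_sec_eq A);
     pt_split := pb1_lift _ _ |}.

Lemma point_pullback_eq (A A' : Points B) (h : Hom A A') :
  p ∘ pb1 (fc_pullback L p (pt_map A))
  = pt_map A' ∘ (proj1_sig h ∘ pb2 (fc_pullback L p (pt_map A))).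
Proof. rewrite comp_assoc, (proj1 (proj2_sig h)). apply pb_square. Qed.

Definition point_pullback_hom (A A' : Points B) (h : Hom A A') :
  Hom (point_pullback_ob A) (point_pullback_ob A').
Proof.
  exists (pb_lift (fc_pullback L p (pt_map A')) (point_pullback_eq h)).
  split; [apply pb1_lift|]. simpl. apply pb_joint_mono.
  - now rewrite comp_assoc, !pb1_lift.
  - rewrite comp_assoc, !pb2_lift, <- comp_assoc, pb2_lift, comp_assoc.
    now rewrite (proj2 (proj2_sig h)).
Defined.

Definition point_pullback : Functor (Points B) (Points E).
Proof.
  refine {| fob := point_pullback_ob; fmap := point_pullback_hom |}.
  - intro A. apply sig_ext; simpl. apply pb_joint_mono.
    + now rewrite pb1_lift, comp_id_r.
    + rewrite pb2_lift; simpl. now rewrite comp_id_l, comp_id_r.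
  - intros A A' A'' g f. apply sig_ext; simpl. apply pb_joint_mono.
    + now rewrite comp_assoc, !pb1_lift.
    + rewrite comp_assoc, !pb2_lift, <- !comp_assoc, pb2_lift.
      simpl. now rewrite comp_assoc.
Defined.

End ChangeOfBase.
End Fibrations.

(** * Semi-abelian categories *)

Section SemiAbelian.
Variable X : Category.

Definition kernel_pairs_have_coequalisers : Prop :=
  forall (A B : X) (f : Hom A B) (K : X) (k1 k2 : Hom K A),
    is_pullback f f k1 k2 ->
    exists (Q : X) (q : Hom A Q), is_coequaliser k1 k2 q.

Definition regular_epis_stable : Prop :=
  forall (A E B P : X) (f : Hom A B) (p : Hom E B) (g : Hom P E) (q : Hom P A),
    is_pullback p f g q -> regular_epi f -> regular_epi g.

Definition equivalence_relations_effective : Prop :=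
  forall (A : X) (R : Graph A), equivalence_relation R ->
    exists (B : X) (f : Hom A B), is_pullback f f (gr1 R) (gr2 R).

(** The argument [L] supplies the finite limits that Barr exactness requires. *)
Definition barr_exact (L : FinitelyComplete X) : Prop :=
  kernel_pairs_have_coequalisers /\
  regular_epis_stable /\
  equivalence_relations_effective.

Definition bourn_protomodular (L : FinitelyComplete X) : Prop :=
  forall (E B : X) (p : Hom E B), reflects_isos (point_pullback L p).

Definition semi_abelian (L : FinitelyComplete X) : Prop :=
  pointed X /\ barr_exact L /\ bourn_protomodular L /\ has_binary_coproducts X.

Definition smith_is_huq : Prop :=
  forall (A : X) (R S : Graph A),
    equivalence_relation R -> equivalence_relation S ->
    forall (M N : X) (m : Hom M A) (n : Hom N A),
      is_normalisation R m -> is_normalisation S n ->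
      huq_commute m n -> centralise R S.

Variable L : FinitelyComplete X.

Definition condition_C : Prop :=
  forall (E B : X) (p : Hom E B),
    reflects_commutation_of_normal_subobjects (point_pullback L p).

Definition condition_C_bar : Prop :=
  forall (E B : X) (p : Hom E B), reflects_centralisation (point_pullback L p).

Definition basic_fibration_condition : Prop :=
  forall (E B : X) (p : Hom E B), reflects_centralisation (slice_pullback L p).

End SemiAbelian.

(* Main.v *)
From Stdlib Require Import ProofIrrelevance Relation_Definitions IndefiniteDescription.
Require Import Defs.

(** All reasoning is done with generalised elements. A predicate on elements of
    [A] is representable when it is cut out by a subobject; an equation or an
    instance of a relation is of this kind. Protomodularity is used in two
    forms: a morphism of points that is bijective on the elements of the
    kernels is invertible ([point_map_iso]), hence a representable predicate on
    a point holds everywhere once it holds on the section and on the kernel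
    ([point_generated]). For a product [K × N] this says that a property need
    only be checked on the elements [(x, 0)] and [(0, y)].

    The proof establishes (i) <-> (ii) and (i) -> (iv) -> (iii) -> (i).

    (i) -> (iv). The normalisation of an equivalence relation [R] in the slice
    over [B] lies in the kernel of the structure map, so it is seen by the
    pullback along any [p : E -> B]: the centraliser over [E], evaluated at the
    triples [(x, 0, y)], shows that the normalisations of [R] and [S] commute
    ([sl_normalisations_commute]). Smith is Huq then provides a centraliser in
    the base category, and it is automatically fibrewise over [B]
    ([centraliser_fibrewise]).

    (iv) -> (iii). Over a fixed base, being an equivalence relation and
    centralising mean the same for points and for slices, because the forgetful
    functor from points has a left adjoint, [T |-> T + B] ([free_point]).

    (i) -> (ii). A commutation of the pulled back normal subobjects restricts to
    a commutation, in the base category, of the normalisations of the two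
    equivalence relations. If [theta] is the centraliser which Smith is Huq
    yields, then [(a, b) |-> theta(a, 0, b)], with [0] the zero of the fibre,
    makes the normal subobjects commute.

    (ii) -> (i). An equivalence relation [R] on [A], viewed as a point over [A]
    by its first projection, is a normal subobject of the point [A × A]
    ([relation_point_normal]). Two equivalence relations on [A] centralise each
    other exactly when these normal subobjects commute, and pulling back along
    [0 -> A] turns the latter into the normalisations.

    (iii) -> (i). Let the normalisations [M] and [N] of [R] and [S] commute by
    [phi : M × N -> A]. Take the point over [A] of triples [(x, y, z)] with
    [x R y S z], projected to [x], with the two relations [x = x', z R z'] and
    [x = x', y = y']. The kernel of this point is [M × N], by
    [(k, l) |-> (0, k, phi(k, l))] ([product_coordinates]). On it the second
    relation is equality of the coordinates [k], the first one relates only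
    elements with [l R l'], and [M ∩ N] is central in [N], so differences of [R]-related
    elements of [N] exist ([central_division]) and the two relations centralise
    each other ([kernel_centralise]). By (iii) they already do so over [A], and
    evaluating at [(y, x, x)], [(y, y, y)], [(y, y, z)] gives a centraliser of
    [R] and [S]. *)

Set Implicit Arguments.
Unset Strict Implicit.
Local Open Scope cat_scope.

(** * Zero morphisms, products and representable predicates *)

(** Being pointed is a mere existence statement; choosing the zero object and
    its morphisms once makes zero morphisms and products into functions. *)
Record ZeroData (X : Category) := {
  zob :> X;
  to0 : forall A : X, Hom A zob;
  from0 : forall A : X, Hom zob A;
  to0_unique : forall (A : X) (f g : Hom A zob), f = g;
  from0_unique : forall (A : X) (f g : Hom zob A), f = g }.

Lemma zero_data_of_pointed (X : Category) : pointed X -> inhabited (ZeroData X).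
Proof.
  intros [Z [Hi Ht]].
  assert (t : forall A : X, {f : Hom A Z | unique (fun _ => True) f})
    by (intro A; apply constructive_indefinite_description, Ht).
  assert (i : forall A : X, {f : Hom Z A | unique (fun _ => True) f})
    by (intro A; apply constructive_indefinite_description, Hi).
  constructor.
  refine {| zob := Z; to0 := fun A => proj1_sig (t A);
            from0 := fun A => proj1_sig (i A) |}.
  - intros A f g. destruct (t A) as [h [_ Hh]].
    now rewrite <- (Hh f I), <- (Hh g I).
  - intros A f g. destruct (i A) as [h [_ Hh]].
    now rewrite <- (Hh f I), <- (Hh g I).
Qed.

Lemma reassoc (X : Category) (A B D : X) (g : Hom B D) (f : Hom A B)
  (h : Hom A D) : g ∘ f = h -> forall (T : X) (u : Hom T A), g ∘ (f ∘ u) = h ∘ u.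
Proof. intros e T u. now rewrite comp_assoc, e. Qed.

Section FiniteLimits.
Variable X : Category.
Variable L : FinitelyComplete X.
Variable Z : ZeroData X.

Definition zero (A B : X) : Hom A B := from0 Z B ∘ to0 Z A.

Lemma zero_l (A B D : X) (f : Hom A B) : zero B D ∘ f = zero A D.
Proof. unfold zero. rewrite <- comp_assoc. f_equal. apply to0_unique. Qed.

Lemma zero_r (A B D : X) (f : Hom B D) : f ∘ zero A B = zero A D.
Proof. unfold zero. rewrite comp_assoc. f_equal. apply from0_unique. Qed.

Lemma from0_zero (A B : X) (h : Hom A Z) : from0 Z B ∘ h = zero A B.
Proof. unfold zero. f_equal. apply to0_unique. Qed.

Lemma zero_mor_iff (A B : X) (f : Hom A B) : is_zero_mor f <-> f = zero A B.
Proof.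
  split.
  - intros (Z' & g & h & [Hi Ht] & ->).
    destruct (Hi B) as [g' [_ Hg]].
    rewrite <- (Hg g I), (Hg (zero Z' B) I). apply zero_l.
  - intros ->. exists Z, (from0 Z B), (to0 Z A). split; [|reflexivity].
    split; intro D.
    + exists (from0 Z D). split; [exact I|]. intros; apply from0_unique.
    + exists (to0 Z D). split; [exact I|]. intros; apply to0_unique.
Qed.

Section ChosenPullback.
Variables A B D : X.
Variables (f : Hom A D) (g : Hom B D).
Let P := fc_pullback L f g.

Lemma pb1_lift_comp (T T' : X) (x : Hom T A) (y : Hom T B) (e : f ∘ x = g ∘ y)
  (u : Hom T' T) : pb1 P ∘ (pb_lift P e ∘ u) = x ∘ u.
Proof. apply reassoc, pb1_lift. Qed.

Lemma pb2_lift_comp (T T' : X) (x : Hom T A) (y : Hom T B) (e : f ∘ x = g ∘ y)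
  (u : Hom T' T) : pb2 P ∘ (pb_lift P e ∘ u) = y ∘ u.
Proof. apply reassoc, pb2_lift. Qed.

Lemma pb_square_comp (T : X) (u : Hom T (pb P)) :
  f ∘ (pb1 P ∘ u) = g ∘ (pb2 P ∘ u).
Proof. rewrite !comp_assoc. f_equal. apply pb_square. Qed.
End ChosenPullback.

Definition prod_pb (A B : X) := fc_pullback L (to0 Z A) (to0 Z B).
Definition prod (A B : X) : X := pb (prod_pb A B).
Definition pr1 (A B : X) : Hom (prod A B) A := pb1 (prod_pb A B).
Definition pr2 (A B : X) : Hom (prod A B) B := pb2 (prod_pb A B).
Definition pair (T A B : X) (x : Hom T A) (y : Hom T B) : Hom T (prod A B) :=
  pb_lift (prod_pb A B) (to0_unique (to0 Z A ∘ x) (to0 Z B ∘ y)).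

Lemma pr1_pair (T A B : X) (x : Hom T A) (y : Hom T B) : pr1 A B ∘ pair x y = x.
Proof. apply pb1_lift. Qed.
Lemma pr2_pair (T A B : X) (x : Hom T A) (y : Hom T B) : pr2 A B ∘ pair x y = y.
Proof. apply pb2_lift. Qed.
Lemma prod_ext (T A B : X) (u v : Hom T (prod A B)) :
  pr1 A B ∘ u = pr1 A B ∘ v -> pr2 A B ∘ u = pr2 A B ∘ v -> u = v.
Proof. apply pb_joint_mono. Qed.
Lemma pair_comp (T' T A B : X) (x : Hom T A) (y : Hom T B) (u : Hom T' T) :
  pair x y ∘ u = pair (x ∘ u) (y ∘ u).
Proof.
  apply prod_ext; rewrite comp_assoc.
  - now rewrite !pr1_pair.
  - now rewrite !pr2_pair.
Qed.
Lemma pair_eta (T A B : X) (u : Hom T (prod A B)) :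
  pair (pr1 A B ∘ u) (pr2 A B ∘ u) = u.
Proof. apply prod_ext; [apply pr1_pair | apply pr2_pair]. Qed.
Lemma prod_is_product (A B : X) : is_product (pr1 A B) (pr2 A B).
Proof.
  intros T x y. exists (pair x y). split.
  - split; [apply pr1_pair | apply pr2_pair].
  - intros u [<- <-]. apply pair_eta.
Qed.

Definition monic (A B : X) (m : Hom A B) : Prop :=
  forall (T : X) (u v : Hom T A), m ∘ u = m ∘ v -> u = v.

(** Subobjects are handled through their elements: [F] is a formula about
    generalised elements of [A], and [m] its extension. *)
Definition represents (M A : X) (m : Hom M A) (F : forall T, Hom T A -> Prop) :=
  monic m /\ forall (T : X) (a : Hom T A), F T a <-> exists u, m ∘ u = a.

Definition representable (A : X) (F : forall T, Hom T A -> Prop) : Prop :=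
  exists (M : X) (m : Hom M A), represents m F.

(** The subobject is the inverse image of [R] along [(f, g)]. *)
Lemma representable_related (A Y : X) (R : Graph Y) (f g : Hom A Y) :
  jointly_monic R ->
  representable (fun T (a : Hom T A) => related R (f ∘ a) (g ∘ a)).
Proof.
  intro HR.
  set (P := fc_pullback L (pair f g) (pair (gr1 R) (gr2 R))).
  assert (E : forall T (a : Hom T A) (c : Hom T (gr_ob R)),
    pair f g ∘ a = pair (gr1 R) (gr2 R) ∘ c <->
    gr1 R ∘ c = f ∘ a /\ gr2 R ∘ c = g ∘ a).
  { intros T a c. rewrite !pair_comp. split.
    - intro e. split.
      + apply (f_equal (comp (pr1 Y Y))) in e. now rewrite !pr1_pair in e.
      + apply (f_equal (comp (pr2 Y Y))) in e. now rewrite !pr2_pair in e.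
    - intros [-> ->]. reflexivity. }
  exists (pb P), (pb1 P). split.
  - intros T u v e. apply pb_joint_mono; [exact e|].
    destruct (proj1 (E _ _ _) (pb_square_comp u)) as [u1 u2].
    destruct (proj1 (E _ _ _) (pb_square_comp v)) as [v1 v2].
    fold P in u1, u2, v1, v2.
    apply HR; [rewrite u1, v1 | rewrite u2, v2]; now rewrite e.
  - intros T a. split.
    + intros [c Hc]. exists (pb_lift P (proj2 (E _ _ _) Hc)). apply pb1_lift.
    + intros [u <-]. exists (pb2 P ∘ u).
      exact (proj1 (E _ _ _) (pb_square_comp u)).
Qed.

Lemma representable_equal (A Y : X) (f g : Hom A Y) :
  representable (fun T (a : Hom T A) => f ∘ a = g ∘ a).
Proof.
  destruct (@representable_related A Y
    {| gr_ob := Y; gr1 := idm Y; gr2 := idm Y |} f g) as (M & m & Hm & H).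
  - intros T a b. simpl. now rewrite !comp_id_l.
  - exists M, m. split; [exact Hm|]. intros T a. rewrite <- H.
    unfold related; simpl. split.
    + intro e. exists (f ∘ a). now rewrite !comp_id_l.
    + intros [c [<- <-]]. reflexivity.
Qed.

Lemma representable_and (A : X) (F G : forall T, Hom T A -> Prop) :
  representable F -> representable G -> representable (fun T a => F T a /\ G T a).
Proof.
  intros (M & m & Hm & HF) (N & n & Hn & HG).
  set (P := fc_pullback L m n).
  exists (pb P), (m ∘ pb1 P). split.
  - intros T u v e. rewrite <- !comp_assoc in e. apply Hm in e as e1.
    apply pb_joint_mono; [exact e1|]. apply Hn.
    change (n ∘ (pb2 P ∘ u) = n ∘ (pb2 P ∘ v)).
    unfold P. rewrite <- !pb_square_comp. exact e.
  - intros T a. rewrite HF, HG. split.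
    + intros [[u Hu] [v Hv]].
      assert (e : m ∘ u = n ∘ v) by congruence.
      exists (pb_lift P e). now rewrite <- comp_assoc, pb1_lift.
    + intros [u <-]. split.
      * exists (pb1 P ∘ u). apply comp_assoc.
      * exists (pb2 P ∘ u). unfold P.
        now rewrite <- pb_square_comp, comp_assoc.
Qed.

Lemma graph_of_representable (A : X) (F : forall T, Hom T (prod A A) -> Prop) :
  representable F ->
  exists G : Graph A, jointly_monic G /\
    forall (T : X) (x y : Hom T A), related G x y <-> F T (pair x y).
Proof.
  intros (M & m & Hm & HF).
  exists {| gr_ob := M; gr1 := pr1 A A ∘ m; gr2 := pr2 A A ∘ m |}. split.
  - intros T a b; simpl; intros e1 e2. rewrite <- !comp_assoc in e1, e2.
    apply Hm, prod_ext; assumption.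
  - intros T x y. rewrite HF. unfold related; simpl. split; intros [u Hu]; exists u.
    + destruct Hu as [<- <-]. rewrite <- !comp_assoc. now rewrite pair_eta.
    + now rewrite <- !comp_assoc, Hu, pr1_pair, pr2_pair.
Qed.

(** * Consequences of protomodularity *)

Hypothesis HP : bourn_protomodular L.

(** Pulling back along [0 -> B] sends a point to its kernel and reflects
    isomorphisms; the two last hypotheses say that [h] is bijective on the
    elements of the kernels. *)
Lemma point_map_iso (A A' B : X) (f : Hom A B) (s : Hom B A)
    (f' : Hom A' B) (s' : Hom B A') (h : Hom A A') :
  f ∘ s = idm B -> f' ∘ s' = idm B -> f' ∘ h = f -> h ∘ s = s' ->
  (forall T (a' : Hom T A'), f' ∘ a' = zero T B ->
     exists a : Hom T A, f ∘ a = zero T B /\ h ∘ a = a') ->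
  (forall T (a b : Hom T A), f ∘ a = zero T B -> f ∘ b = zero T B ->
     h ∘ a = h ∘ b -> a = b) ->
  is_iso h.
Proof.
  intros e e' hf hs Hsurj Hinj.
  set (PA := Build_PointOb e). set (PA' := Build_PointOb e').
  set (hh := exist _ h (conj hf hs) : @Hom (Points B) PA PA').
  set (p := from0 Z B).
  assert (Hiso : is_iso hh).
  { apply (HP (p := p)).
    set (Q := fc_pullback L p f). set (Q' := fc_pullback L p f').
    set (H := pb_lift Q' (@point_pullback_eq X L Z B p PA PA' hh)).
    assert (z : f ∘ pb2 Q = zero _ _)
      by (rewrite <- (pb_square Q); apply from0_zero).
    assert (z' : f' ∘ pb2 Q' = zero _ _)
      by (rewrite <- (pb_square Q'); apply from0_zero).
    destruct (Hsurj _ _ z') as [a [fa ha]].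
    assert (ea : p ∘ pb1 Q' = f ∘ a) by (rewrite fa; apply from0_zero).
    (* Surjectivity at the universal element of the kernel of [f'] is the inverse. *)
    set (g := pb_lift Q ea).
    unshelve eexists.
    { exists g. split; [apply pb1_lift | apply from0_unique]. }
    assert (H2 : pb2 Q' ∘ H = h ∘ pb2 Q) by apply pb2_lift.
    split; apply sig_ext; simpl; apply pb_joint_mono; try apply to0_unique.
    - fold Q Q'. change (pb2 Q ∘ (g ∘ H) = pb2 Q ∘ idm _).
      unfold g, Q. rewrite pb2_lift_comp, comp_id_r. apply Hinj.
      + now rewrite comp_assoc, fa, zero_l.
      + exact z.
      + now rewrite comp_assoc, ha.
    - fold Q Q'. change (pb2 Q' ∘ (H ∘ g) = pb2 Q' ∘ idm _).
      rewrite comp_assoc, H2, <- comp_assoc. unfold g.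
      now rewrite pb2_lift, ha, comp_id_r. }
  destruct Hiso as [[g Hg] [e1 e2]].
  exists g. split.
  - exact (f_equal (@proj1_sig _ _) e1).
  - exact (f_equal (@proj1_sig _ _) e2).
Qed.

(** The subobject representing [F] contains the section, hence is a point, and
    its inclusion satisfies the hypotheses of [point_map_iso]. *)
Lemma point_generated (A B : X) (f : Hom A B) (s : Hom B A)
    (F : forall T, Hom T A -> Prop) :
  f ∘ s = idm B -> representable F -> F B s ->
  (forall T (a : Hom T A), f ∘ a = zero T B -> F T a) ->
  forall T (a : Hom T A), F T a.
Proof.
  intros e (M & m & Hm & HF) Hs Hk T a.
  destruct (proj1 (HF _ _) Hs) as [s' Hs'].
  assert (Hiso : is_iso m).
  { apply (@point_map_iso M A B (f ∘ m) s' f s m); auto.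
    - now rewrite <- comp_assoc, Hs'.
    - intros T' a' za. destruct (proj1 (HF _ _) (Hk _ _ za)) as [u Hu].
      exists u. now rewrite <- comp_assoc, Hu. }
  destruct Hiso as [g [_ mg]].
  apply HF. exists (g ∘ a). now rewrite comp_assoc, mg, comp_id_l.
Qed.

(** The product is a point over [K], with section [(1, 0)] and with the elements
    [(0, y)] as its kernel. *)
Lemma product_generated (K N : X) (F : forall T, Hom T (prod K N) -> Prop) :
  representable F ->
  F K (pair (idm K) (zero K N)) ->
  (forall T (y : Hom T N), F T (pair (zero T K) y)) ->
  forall T (a : Hom T (prod K N)), F T a.
Proof.
  intros HF H1 H2. apply (point_generated (pr1_pair (idm K) (zero K N))); auto.
  intros T a e. rewrite <- (pair_eta a), e. apply H2.
Qed.

(** * Equivalence relations, normalisations and commutation *)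

Lemma related_comp (A T T' : X) (R : Graph A) (x y : Hom T A) (u : Hom T' T) :
  related R x y -> related R (x ∘ u) (y ∘ u).
Proof. intros [a [<- <-]]. exists (a ∘ u). now rewrite !comp_assoc. Qed.

Lemma reflexivity_map (A : X) (R : Graph A) : equivalence_relation R ->
  exists r : Hom A (gr_ob R), gr1 R ∘ r = idm A /\ gr2 R ∘ r = idm A.
Proof. intros [_ H]. exact (equiv_refl _ _ (H A) (idm A)). Qed.

Lemma symmetry_map (A : X) (R : Graph A) : equivalence_relation R ->
  exists s : Hom (gr_ob R) (gr_ob R), gr1 R ∘ s = gr2 R /\ gr2 R ∘ s = gr1 R.
Proof.
  intros [_ H]. apply (equiv_sym _ _ (H (gr_ob R)) (gr1 R) (gr2 R)).
  exists (idm _). now rewrite !comp_id_r.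
Qed.

(** The normalisation is the class of zero, since the kernel of the first
    projection consists of the pairs [(0, y)] in [R]. *)
Lemma normalisation_iff (A M : X) (R : Graph A) (m : Hom M A) :
  jointly_monic R ->
  (is_normalisation R m <->
   represents m (fun T (y : Hom T A) => related R (zero T A) y)).
Proof.
  intro HR. split.
  - intros (k & [Hz Hk] & ->). apply zero_mor_iff in Hz.
    assert (Huniq : forall T (u v : Hom T M), k ∘ u = k ∘ v -> u = v).
    { intros T u v e. destruct (Hk T (k ∘ v)) as [w [_ Hw]].
      - rewrite comp_assoc, Hz, zero_l. now apply zero_mor_iff.
      - now rewrite <- (Hw u e), <- (Hw v eq_refl). }
    split.
    + intros T u v e. rewrite <- !comp_assoc in e. apply Huniq, HR; [|exact e].
      now rewrite !comp_assoc, Hz, !zero_l.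
    + intros T y. split.
      * intros [a [a1 <-]]. destruct (Hk T a) as [u [Hu _]].
        { now apply zero_mor_iff. }
        exists u. now rewrite <- comp_assoc, Hu.
      * intros [u <-]. exists (k ∘ u). split; [|apply comp_assoc].
        now rewrite comp_assoc, Hz, zero_l.
  - intros [Hm H]. destruct (proj2 (H M m)) as [k [k1 k2]].
    { exists (idm M). apply comp_id_r. }
    exists k. split; [split|now symmetry].
    + now apply zero_mor_iff.
    + intros T h Hh. apply zero_mor_iff in Hh.
      destruct (proj1 (H T (gr2 R ∘ h))) as [u Hu]; [now exists h|].
      exists u. split.
      * apply HR; rewrite comp_assoc; [|now rewrite k2].
        now rewrite k1, zero_l.
      * intros v <-. apply Hm. now rewrite Hu, <- k2, comp_assoc.
Qed.

Lemma normalisation_exists (A : X) (R : Graph A) : jointly_monic R ->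
  exists (M : X) (m : Hom M A), is_normalisation R m.
Proof.
  intro HR.
  destruct (representable_related (zero A A) (idm A) HR) as (M & m & Hm & H).
  exists M, m. apply normalisation_iff; [exact HR|]. split; [exact Hm|].
  intros T y. rewrite <- H, zero_l, comp_id_l. reflexivity.
Qed.

(** A product occurring in [huq_commute] is arbitrary; the chosen one serves as
    well, and its elements are pairs. *)
Lemma huq_commute_iff (K N A : X) (k : Hom K A) (l : Hom N A) :
  huq_commute k l <->
  exists phi : Hom (prod K N) A,
    (forall T (x : Hom T K), phi ∘ pair x (zero T N) = k ∘ x) /\
    (forall T (y : Hom T N), phi ∘ pair (zero T K) y = l ∘ y).
Proof.
  split.
  - intros (P & p & q & i & j & phi & HP' & [pi qi] & [pj qj] & <- & <-).
    apply zero_mor_iff in qi, pj.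
    destruct (HP' _ (pr1 K N) (pr2 K N)) as [u [[pu qu] _]].
    assert (Hext : forall T (a b : Hom T P), p ∘ a = p ∘ b -> q ∘ a = q ∘ b -> a = b).
    { intros T a b e1 e2. destruct (HP' T (p ∘ b) (q ∘ b)) as [w [_ Hw]].
      now rewrite <- (Hw a (conj e1 e2)), <- (Hw b (conj eq_refl eq_refl)). }
    exists (phi ∘ u). split; intros T x; rewrite <- !comp_assoc; f_equal; apply Hext;
      rewrite !comp_assoc, ?pu, ?qu, ?pi, ?qi, ?pj, ?qj, ?pr1_pair, ?pr2_pair,
        ?comp_id_l, ?zero_l; reflexivity.
  - intros (phi & H1 & H2).
    exists (prod K N), (pr1 K N), (pr2 K N), (pair (idm K) (zero K N)),
      (pair (zero N K) (idm N)), phi.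
    repeat split; rewrite ?pr1_pair, ?pr2_pair, ?H1, ?H2, ?comp_id_r; trivial;
      try (now apply zero_mor_iff); apply prod_is_product.
Qed.

Lemma pullback_ext (C : Category) (A B D P : C) (f : Hom A D) (g : Hom B D)
  (p : Hom P A) (q : Hom P B) : is_pullback f g p q ->
  forall T (u v : Hom T P), p ∘ u = p ∘ v -> q ∘ u = q ∘ v -> u = v.
Proof.
  intros [Hsq Hu] T u v e1 e2. destruct (Hu T (p ∘ v) (q ∘ v)) as [w [_ Hw]].
  - now rewrite !comp_assoc, Hsq.
  - now rewrite <- (Hw u (conj e1 e2)), <- (Hw v (conj eq_refl eq_refl)).
Qed.

(** If [R] and [S] are relations over [B], then [theta(x, y, z)] lies over the
    same element as [y]. The pullback is a point over [R] with section
    [(x, y) |-> (x, y, y)], where [theta] is [x]; its kernel consists of the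
    triples [(0, 0, z)], where [theta] is [z]; and [x], [y], [z] all lie over the
    same element. *)
Lemma centraliser_fibrewise (A B P : X) (R S : Graph A) (f : Hom A B)
    (p : Hom P (gr_ob R)) (q : Hom P (gr_ob S)) (theta : Hom P A) :
  equivalence_relation S ->
  f ∘ gr1 R = f ∘ gr2 R -> f ∘ gr1 S = f ∘ gr2 S ->
  is_pullback (gr2 R) (gr1 S) p q ->
  (forall (T : X) (u : Hom T P),
     gr1 S ∘ (q ∘ u) = gr2 S ∘ (q ∘ u) -> theta ∘ u = gr1 R ∘ (p ∘ u)) ->
  (forall (T : X) (u : Hom T P),
     gr1 R ∘ (p ∘ u) = gr2 R ∘ (p ∘ u) -> theta ∘ u = gr2 S ∘ (q ∘ u)) ->
  f ∘ theta = f ∘ (gr2 R ∘ p).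
Proof.
  intros HS fR fS Hpb H1 H2.
  destruct (reflexivity_map HS) as (r & r1 & r2).
  assert (e : gr2 R ∘ idm _ = gr1 S ∘ (r ∘ gr2 R))
    by (now rewrite comp_assoc, r1, comp_id_l, comp_id_r).
  destruct (proj2 Hpb _ _ _ e) as [s [[ps qs] _]].
  rewrite <- (comp_id_r (f ∘ theta)), <- (comp_id_r (f ∘ (gr2 R ∘ p))).
  apply (@point_generated P (gr_ob R) p s
    (fun T a => (f ∘ theta) ∘ a = (f ∘ (gr2 R ∘ p)) ∘ a)).
  - exact ps.
  - apply representable_equal.
  - rewrite <- !comp_assoc, H1, ps.
    + now rewrite !comp_id_r.
    + now rewrite qs, !comp_assoc, r1, r2.
  - intros T a e0. rewrite <- !comp_assoc, H2.
    + rewrite comp_assoc, <- fS, <- comp_assoc. f_equal.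
      rewrite !comp_assoc. f_equal. symmetry. apply Hpb.
    + now rewrite e0, !zero_r.
Qed.

(** * Slices *)

Definition sl_graph (B : X) (A : Slice B) (G : Graph A) : Graph (sl_ob A) :=
  {| gr_ob := sl_ob (gr_ob G); gr1 := proj1_sig (gr1 G); gr2 := proj1_sig (gr2 G) |}.

Lemma sl_related (B : X) (A : Slice B) (G : Graph A) (T : Slice B)
  (x y : Hom T A) :
  related G x y <-> related (sl_graph G) (proj1_sig x) (proj1_sig y).
Proof.
  split.
  - intros [a [<- <-]]. now exists (proj1_sig a).
  - intros [a [a1 a2]]. simpl in *.
    assert (e : sl_map (gr_ob G) ∘ a = sl_map T).
    { now rewrite <- (proj2_sig (gr1 G)), <- comp_assoc, a1, (proj2_sig x). }
    exists (exist _ a e). split; now apply sig_ext.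
Qed.

(** Related elements of [A] lie over the same element of [B], so a relation
    between elements with arbitrary domain [T] can be tested in the slice,
    with [T] viewed over [B] through either of them. *)
Lemma sl_equivalence (B : X) (A : Slice B) (G : Graph A) :
  equivalence_relation G <-> equivalence_relation (sl_graph G).
Proof.
  assert (E1 := proj2_sig (gr1 G)). assert (E2 := proj2_sig (gr2 G)).
  simpl in E1, E2.
  split; intros [Hjm H].
  - split.
    + intros T a b; simpl; intros e1 e2.
      assert (eb : sl_map (gr_ob G) ∘ b = sl_map (gr_ob G) ∘ a)
        by (now rewrite <- E1, <- !comp_assoc, e1).
      set (T' := {| sl_ob := T; sl_map := sl_map (gr_ob G) ∘ a |} : Slice B).
      set (a' := exist _ a eq_refl : Hom T' (gr_ob G)).
      set (b' := exist _ b eb : Hom T' (gr_ob G)).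
      assert (e : a' = b') by (apply Hjm; now apply sig_ext).
      exact (f_equal (@proj1_sig _ _) e).
    + assert (Hf : forall T (x y : Hom T (sl_ob A)), related (sl_graph G) x y ->
        sl_map A ∘ y = sl_map A ∘ x).
      { intros T x y [a [<- <-]]; simpl. now rewrite !comp_assoc, E1, E2. }
      pose (lift := fun T (x y : Hom T (sl_ob A)) (e : sl_map A ∘ y = sl_map A ∘ x) =>
        exist _ y e : @Hom (Slice B) {| sl_ob := T; sl_map := sl_map A ∘ x |} A).
      intro T. constructor.
      * intro x. exact (proj1 (sl_related _ _ _)
          (equiv_refl _ _ (H _) (lift T x x eq_refl))).
      * intros x y z' Hxy Hyz.
        assert (exy := Hf _ _ _ Hxy). assert (eyz := Hf _ _ _ Hyz).
        rewrite exy in eyz.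
        refine (proj1 (sl_related _ _ _) (equiv_trans _ _ (H _)
          (lift T x x eq_refl) (lift T x y exy) (lift T x z' eyz) _ _));
          now apply sl_related.
      * intros x y Hxy. assert (exy := Hf _ _ _ Hxy).
        refine (proj1 (sl_related _ _ _) (equiv_sym _ _ (H _)
          (lift T x x eq_refl) (lift T x y exy) _)); now apply sl_related.
  - split.
    + intros T a b e1 e2. apply sig_ext, Hjm.
      * exact (f_equal (@proj1_sig _ _) e1).
      * exact (f_equal (@proj1_sig _ _) e2).
    + intro T. constructor.
      * intro x. apply sl_related, (equiv_refl _ _ (H _)).
      * intros x y z' Hxy Hyz. apply sl_related in Hxy, Hyz. apply sl_related.
        exact (equiv_trans _ _ (H _) _ _ _ Hxy Hyz).
      * intros x y Hxy. apply sl_related in Hxy. apply sl_related.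
        exact (equiv_sym _ _ (H _) _ _ Hxy).
Qed.

Lemma sl_fibrewise (B : X) (A : Slice B) (G : Graph A) :
  sl_map A ∘ gr1 (sl_graph G) = sl_map A ∘ gr2 (sl_graph G).
Proof.
  simpl. exact (eq_trans (proj2_sig (gr1 G)) (eq_sym (proj2_sig (gr2 G)))).
Qed.

Lemma sl_centralise (B : X) (A : Slice B) (G H : Graph A) :
  equivalence_relation H ->
  centralise (sl_graph G) (sl_graph H) -> centralise G H.
Proof.
  intros HH (P & p & q & theta & Hpb & H1 & H2).
  apply sl_equivalence in HH.
  assert (Ht := centraliser_fibrewise HH (sl_fibrewise G) (sl_fibrewise H)
    Hpb H1 H2).
  assert (eG := proj2_sig (gr2 G)). assert (eH := proj2_sig (gr1 H)).
  simpl in eG, eH.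
  assert (sq : proj1_sig (gr2 G) ∘ p = proj1_sig (gr1 H) ∘ q) by apply Hpb.
  set (P' := {| sl_ob := P; sl_map := sl_map A ∘ (gr2 (sl_graph G) ∘ p) |} : Slice B).
  assert (ep : sl_map (gr_ob G) ∘ p = sl_map P')
    by (simpl; now rewrite comp_assoc, eG).
  assert (eq : sl_map (gr_ob H) ∘ q = sl_map P')
    by (simpl; now rewrite sq, comp_assoc, eH).
  exists P', (exist _ p ep), (exist _ q eq), (exist _ theta Ht).
  split; [split|split].
  - now apply sig_ext.
  - intros T x y e. apply (f_equal (@proj1_sig _ _)) in e.
    destruct (proj2 Hpb _ _ _ e) as [u [[pu qu] Hu]].
    assert (eu : sl_map P' ∘ u = sl_map T).
    { rewrite <- ep, <- comp_assoc.
      exact (eq_trans (f_equal (comp _) pu) (proj2_sig x)). }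
    exists (exist _ u eu). split.
    + split; now apply sig_ext.
    + intros v [<- <-]. apply sig_ext, Hu. now split.
  - intros T u e. apply sig_ext, H1. exact (f_equal (@proj1_sig _ _) e).
  - intros T u e. apply sig_ext, H2. exact (f_equal (@proj1_sig _ _) e).
Qed.

(** Elements [x] and [y] of the two normalisations lie over zero, so they give a
    triple [x R 0 S y] over the zero of [E]. The cooperator is
    [(x, y) |-> theta(x, 0, y)], with [theta] the centraliser over [E]; its laws
    are those of [theta] at [y = 0] and at [x = 0]. *)
Lemma sl_normalisations_commute (E B M N : X) (p : Hom E B) (A : Slice B)
    (R S : Graph A) (m : Hom M (sl_ob A)) (n : Hom N (sl_ob A)) :
  equivalence_relation R -> equivalence_relation S ->
  is_normalisation (sl_graph R) m -> is_normalisation (sl_graph S) n ->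
  centralise (graph_image (slice_pullback L p) R)
    (graph_image (slice_pullback L p) S) ->
  huq_commute m n.
Proof.
  intros HR HS Hm Hn (P & a & b & theta & Hpb & H1 & H2).
  assert (mapR := proj2_sig (gr2 R)). assert (mapS := proj2_sig (gr1 S)).
  apply sl_equivalence in HR, HS.
  apply (normalisation_iff _ (proj1 HR)) in Hm.
  apply (normalisation_iff _ (proj1 HS)) in Hn.
  destruct (equiv_sym _ _ (proj2 HR M) _ _
    (proj2 (proj2 Hm M m) (ex_intro _ (idm M) (comp_id_r m)))) as (k & k1 & k2).
  destruct (proj2 (proj2 Hn N n) (ex_intro _ (idm N) (comp_id_r n)))
    as (l & l1 & l2).
  (* [k] picks the pair [(x, 0)] in [R], the reverse of the pair that defines
     the normalisation, and [l] picks [(0, y)] in [S]. *)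
  simpl in k, k1, k2, l, l1, l2, mapR, mapS.
  assert (ek : p ∘ zero (prod M N) E = sl_map (gr_ob R) ∘ (k ∘ pr1 M N)).
  { now rewrite <- mapR, <- comp_assoc, (comp_assoc (proj1_sig (gr2 R))), k2,
      zero_l, !zero_r. }
  assert (el : p ∘ zero (prod M N) E = sl_map (gr_ob S) ∘ (l ∘ pr2 M N)).
  { now rewrite <- mapS, <- comp_assoc, (comp_assoc (proj1_sig (gr1 S))), l1,
      zero_l, !zero_r. }
  set (K := {| sl_ob := prod M N; sl_map := zero (prod M N) E |} : Slice E).
  set (FR := fc_pullback L p (sl_map (gr_ob R))) in *.
  set (FS := fc_pullback L p (sl_map (gr_ob S))) in *.
  set (FA := fc_pullback L p (sl_map A)) in *.
  set (x := exist _ (pb_lift FR ek) (pb1_lift _ ek)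
    : Hom K (slice_pullback_ob L p (gr_ob R))).
  set (y := exist _ (pb_lift FS el) (pb1_lift _ el)
    : Hom K (slice_pullback_ob L p (gr_ob S))).
  destruct (proj2 Hpb K x y) as [u [[xu yu] _]].
  { apply sig_ext; simpl. fold FR FS FA. apply pb_joint_mono.
    - unfold FA, FR, FS. now rewrite !comp_assoc, !pb1_lift.
    - unfold FA. rewrite !comp_assoc, !pb2_lift.
      fold FR FS. rewrite <- !comp_assoc.
      unfold FR, FS. rewrite !pb2_lift.
      now rewrite !comp_assoc, k2, l1, !zero_l. }
  apply huq_commute_iff. exists (pb2 FA ∘ (proj1_sig theta ∘ proj1_sig u)).
  split; intros T t.
  - set (v := exist _ (pair t (zero T N)) (zero_l _ _)
      : Hom ({| sl_ob := T; sl_map := zero T E |} : Slice E) K).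
    assert (e := H1 _ (u ∘ v)).
    rewrite (reassoc xu v), (reassoc yu v) in e.
    lapply e; clear e; [intro e|].
    + assert (e' := f_equal (@proj1_sig _ _) e). simpl in e'.
      rewrite <- !comp_assoc. fold FA in e'. etransitivity.
      { apply f_equal. exact e'. }
      unfold FA at 1. rewrite pb2_lift_comp, <- comp_assoc. fold FR.
      unfold FR at 1. rewrite pb2_lift_comp, <- comp_assoc, pr1_pair.
      now rewrite comp_assoc, k1.
    + apply sig_ext; simpl. fold FS FA. apply pb_joint_mono.
      * unfold FA. now rewrite !pb1_lift_comp.
      * unfold FA. rewrite !pb2_lift_comp, <- !comp_assoc. fold FS. unfold FS.
        rewrite !pb2_lift_comp, <- comp_assoc, pr2_pair, !zero_r. reflexivity.
  - set (v := exist _ (pair (zero T M) t) (zero_l _ _)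
      : Hom ({| sl_ob := T; sl_map := zero T E |} : Slice E) K).
    assert (e := H2 _ (u ∘ v)).
    rewrite (reassoc xu v), (reassoc yu v) in e.
    lapply e; clear e; [intro e|].
    + assert (e' := f_equal (@proj1_sig _ _) e). simpl in e'.
      rewrite <- !comp_assoc. fold FA in e'. etransitivity.
      { apply f_equal. exact e'. }
      unfold FA at 1. rewrite pb2_lift_comp, <- comp_assoc. fold FS.
      unfold FS at 1. rewrite pb2_lift_comp, <- comp_assoc, pr2_pair.
      now rewrite comp_assoc, l2.
    + apply sig_ext; simpl. fold FR FA. apply pb_joint_mono.
      * unfold FA. now rewrite !pb1_lift_comp.
      * unfold FA. rewrite !pb2_lift_comp, <- !comp_assoc. fold FR. unfold FR.
        rewrite !pb2_lift_comp, <- comp_assoc, pr1_pair, !zero_r. reflexivity.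
Qed.

(** * Points *)

(** Unlike the underlying projection, this is left alone by simplification, so
    that composites keep one syntactic form and rewriting finds them. *)
Definition pt_arrow (B : X) (A A' : Points B) (h : Hom A A') :
  Hom (pt_ob A) (pt_ob A') := proj1_sig h.

Lemma pt_arrow_comp (B : X) (A A' A'' : Points B) (g : Hom A' A'')
  (f : Hom A A') : pt_arrow (g ∘ f) = pt_arrow g ∘ pt_arrow f.
Proof. reflexivity. Qed.

Lemma pt_arrow_inj (B : X) (A A' : Points B) (f g : Hom A A') :
  pt_arrow f = pt_arrow g -> f = g.
Proof. apply sig_ext. Qed.

Lemma pt_arrow_map (B : X) (A A' : Points B) (h : Hom A A') :
  pt_map A' ∘ pt_arrow h = pt_map A.
Proof. apply (proj2_sig h). Qed.

Lemma pt_arrow_sec (B : X) (A A' : Points B) (h : Hom A A') :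
  pt_arrow h ∘ pt_sec A = pt_sec A'.
Proof. apply (proj2_sig h). Qed.

Definition pt_graph (B : X) (A : Points B) (G : Graph A) : Graph (pt_ob A) :=
  {| gr_ob := pt_ob (gr_ob G); gr1 := pt_arrow (gr1 G); gr2 := pt_arrow (gr2 G) |}.

Definition slice_of_point (B : X) (A : Points B) : Slice B :=
  {| sl_ob := pt_ob A; sl_map := pt_map A |}.

Definition slice_hom_of_point (B : X) (A A' : Points B) (h : Hom A A') :
  Hom (slice_of_point A) (slice_of_point A') :=
  exist _ (pt_arrow h) (proj1 (proj2_sig h)).

Definition slice_graph_of_points (B : X) (A : Points B) (G : Graph A) :
  Graph (slice_of_point A) :=
  {| gr_ob := slice_of_point (gr_ob G);
     gr1 := slice_hom_of_point (gr1 G); gr2 := slice_hom_of_point (gr2 G) |}.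

Lemma pt_arrow_map_comp (B : X) (A A' : Points B) (h : Hom A A') (T : X)
  (x : Hom T (pt_ob A)) : pt_map A' ∘ (pt_arrow h ∘ x) = pt_map A ∘ x.
Proof. rewrite comp_assoc. f_equal. apply (proj2_sig h). Qed.

Lemma pt_arrow_sec_comp (B : X) (A A' : Points B) (h : Hom A A') (T : X)
  (x : Hom T B) : pt_arrow h ∘ (pt_sec A ∘ x) = pt_sec A' ∘ x.
Proof. rewrite comp_assoc. f_equal. apply (proj2_sig h). Qed.

Lemma pt_map_sec (B : X) (A : Points B) (T : X) (x : Hom T B) :
  pt_map A ∘ (pt_sec A ∘ x) = x.
Proof. now rewrite comp_assoc, pt_split, comp_id_l. Qed.

(** The zero object is the base with its identity, so a zero morphism projects
    to the base and comes back by the section. *)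
Lemma pt_zero_mor_iff (B : X) (A A' : Points B) (h : Hom A A') :
  is_zero_mor h <-> pt_arrow h = pt_sec A' ∘ pt_map A.
Proof.
  assert (from : forall C (g : Hom (zero_point B) C), pt_arrow g = pt_sec C)
    by (intros C g; exact (eq_trans (eq_sym (comp_id_r _)) (pt_arrow_sec g))).
  assert (to : forall C (g : Hom C (zero_point B)), pt_arrow g = pt_map C)
    by (intros C g; exact (eq_trans (eq_sym (comp_id_l _)) (pt_arrow_map g))).
  split.
  - intros (O & g & k & [Hi Ht] & ->).
    destruct (Ht O) as [i [_ Hu]].
    destruct (Hi (zero_point B)) as [o _].
    destruct (Ht (zero_point B)) as [o' _].
    assert (e : o' ∘ o = idm O)
      by now rewrite <- (Hu (o' ∘ o) I), <- (Hu (idm O) I).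
    assert (e' : g ∘ k = (g ∘ o') ∘ (o ∘ k))
      by now rewrite <- comp_assoc, (comp_assoc o'), e, comp_id_l.
    rewrite e', pt_arrow_comp, from, to. reflexivity.
  - intro e.
    destruct (proj1 (zero_point_is_zero B) A') as [g _].
    destruct (proj2 (zero_point_is_zero B) A) as [k _].
    exists (zero_point B), g, k. split; [apply zero_point_is_zero|].
    apply pt_arrow_inj. now rewrite e, pt_arrow_comp, from, to.
Qed.

Lemma pt_hom_exists (B : X) (A A' : Points B) (h : Hom (pt_ob A) (pt_ob A')) :
  pt_map A' ∘ h = pt_map A -> h ∘ pt_sec A = pt_sec A' ->
  exists h' : Hom A A', pt_arrow h' = h.
Proof. intros e1 e2. now exists (exist _ h (conj e1 e2)). Qed.

Hypothesis HC : has_binary_coproducts X.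

(** [F] is the coproduct [T + B], the free point on the object [T] over [B]. It
    lets the elements of a point with arbitrary domain be replaced by
    morphisms of points. *)
Lemma free_point (B T : X) (t : Hom T B) :
  exists (F : Points B) (i : Hom T (pt_ob F)),
    pt_map F ∘ i = t /\
    (forall (A : Points B) (x : Hom T (pt_ob A)), pt_map A ∘ x = t ->
       exists h : Hom F A, pt_arrow h ∘ i = x) /\
    (forall (A : Points B) (h h' : Hom F A),
       pt_arrow h ∘ i = pt_arrow h' ∘ i -> h = h').
Proof.
  destruct (HC T B) as (S & i & j & HS).
  destruct (HS B t (idm B)) as [f [[fi fj] _]].
  assert (Hext : forall (A : X) (u v : Hom S A), u ∘ i = v ∘ i -> u ∘ j = v ∘ j -> u = v).
  { intros A u v e1 e2. destruct (HS A (v ∘ i) (v ∘ j)) as [w [_ Hw]].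
    now rewrite <- (Hw u (conj e1 e2)), <- (Hw v (conj eq_refl eq_refl)). }
  set (F := {| pt_ob := S; pt_map := f; pt_sec := j; pt_split := fj |} : Points B).
  exists F, i. split; [exact fi|split].
  - intros A x e. destruct (HS (pt_ob A) x (pt_sec A)) as [h [[hi hj] _]].
    destruct (@pt_hom_exists B F A h) as [h' Hh'].
    + change (pt_map A ∘ h = f). apply Hext; rewrite <- comp_assoc.
      * now rewrite hi, fi.
      * now rewrite hj, pt_split, fj.
    + exact hj.
    + exists h'. now rewrite Hh'.
  - intros A h h' e. apply sig_ext, Hext; [exact e|].
    exact (eq_trans (proj2 (proj2_sig h)) (eq_sym (proj2 (proj2_sig h')))).
Qed.

(** When the components of [x] and [y] factor through a jointly monic graph, the
    factorisation preserves sections by uniqueness. *)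
Lemma pt_related (B : X) (A : Points B) (G : Graph A) (T : Points B)
  (x y : Hom T A) : jointly_monic (pt_graph G) ->
  (related G x y <-> related (pt_graph G) (pt_arrow x) (pt_arrow y)).
Proof.
  intro HG. split.
  - intros [a [<- <-]]. now exists (pt_arrow a).
  - intros [a [a1 a2]]. simpl in *.
    destruct (@pt_hom_exists B T (gr_ob G) a) as [a' Ha'].
    + rewrite <- (pt_arrow_map_comp (gr1 G)), a1. apply (proj2_sig x).
    + apply HG; rewrite comp_assoc; simpl.
      * rewrite a1. transitivity (pt_sec A); [|symmetry];
          [apply (proj2_sig x) | apply (proj2_sig (gr1 G))].
      * rewrite a2. transitivity (pt_sec A); [|symmetry];
          [apply (proj2_sig y) | apply (proj2_sig (gr2 G))].
    + exists a'. split; apply pt_arrow_inj; now rewrite pt_arrow_comp, Ha'.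
Qed.

(** A relation among morphisms of points is transported to arbitrary elements by
    [free_point], and back by [pt_related]. *)
Lemma pt_equivalence (B : X) (A : Points B) (G : Graph A) :
  equivalence_relation G <-> equivalence_relation (pt_graph G).
Proof.
  split; intros [Hjm H].
  - assert (Hf : forall T (a : Hom T (gr_ob (pt_graph G))),
      pt_map A ∘ (gr1 (pt_graph G) ∘ a) = pt_map (gr_ob G) ∘ a /\
      pt_map A ∘ (gr2 (pt_graph G) ∘ a) = pt_map (gr_ob G) ∘ a)
      by (intros T a; split; apply pt_arrow_map_comp).
    split.
    + intros T a b e1 e2.
      destruct (free_point (pt_map (gr_ob G) ∘ a)) as (F & i & Fi & Fex & Funi).
      destruct (Fex (gr_ob G) a eq_refl) as [a' Ha'].
      destruct (Fex (gr_ob G) b) as [b' Hb'].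
      { now rewrite <- (proj1 (Hf _ a)), <- (proj1 (Hf _ b)), e1. }
      rewrite <- Ha', <- Hb'. f_equal. f_equal.
      apply Hjm; apply Funi; rewrite !pt_arrow_comp, <- !comp_assoc, Ha', Hb'; assumption.
    + intro T. constructor.
      * intro x. destruct (free_point (pt_map A ∘ x)) as (F & i & Fi & Fex & Funi).
        destruct (Fex A x eq_refl) as [x' <-].
        destruct (equiv_refl _ _ (H F) x') as [c [c1 c2]].
        exists (pt_arrow c ∘ i). simpl. rewrite !comp_assoc.
        split; f_equal; [exact (f_equal (@pt_arrow _ _ _) c1)
                        |exact (f_equal (@pt_arrow _ _ _) c2)].
      * intros x y z' [a [<- a2]] [b [b1 <-]].
        destruct (free_point (pt_map (gr_ob G) ∘ a)) as (F & i & Fi & Fex & Funi).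
        destruct (Fex (gr_ob G) a eq_refl) as [a' Ha'].
        destruct (Fex (gr_ob G) b) as [b' Hb'].
        { now rewrite <- (proj2 (Hf _ a)), <- (proj1 (Hf _ b)), a2, b1. }
        assert (e : gr2 G ∘ a' = gr1 G ∘ b').
        { apply Funi. rewrite !pt_arrow_comp, <- !comp_assoc, Ha', Hb'.
          exact (eq_trans a2 (eq_sym b1)). }
        destruct (equiv_trans _ _ (H F) (gr1 G ∘ a') (gr2 G ∘ a') (gr2 G ∘ b'))
          as [c [c1 c2]]; [now exists a' | now exists b' |].
        exists (pt_arrow c ∘ i). rewrite <- Ha', <- Hb'. simpl. rewrite !comp_assoc.
        split; f_equal; [exact (f_equal (@pt_arrow _ _ _) c1)
                        |exact (f_equal (@pt_arrow _ _ _) c2)].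
      * intros x y [a [<- <-]].
        destruct (free_point (pt_map (gr_ob G) ∘ a)) as (F & i & Fi & Fex & Funi).
        destruct (Fex (gr_ob G) a eq_refl) as [a' <-].
        destruct (equiv_sym _ _ (H F) (gr1 G ∘ a') (gr2 G ∘ a')) as [c [c1 c2]];
          [now exists a'|].
        exists (pt_arrow c ∘ i). simpl. rewrite !comp_assoc.
        split; f_equal; [exact (f_equal (@pt_arrow _ _ _) c1)
                        |exact (f_equal (@pt_arrow _ _ _) c2)].
  - split.
    + intros T a b e1 e2. apply sig_ext, Hjm.
      * exact (f_equal (@pt_arrow _ _ _) e1).
      * exact (f_equal (@pt_arrow _ _ _) e2).
    + intro T. constructor.
      * intro x. apply pt_related; [exact Hjm|]. apply (equiv_refl _ _ (H _)).
      * intros x y z' Hxy Hyz. apply pt_related in Hxy, Hyz; try exact Hjm.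
        apply pt_related; [exact Hjm|].
        exact (equiv_trans _ _ (H _) _ _ _ Hxy Hyz).
      * intros x y Hxy. apply pt_related in Hxy; try exact Hjm.
        apply pt_related; [exact Hjm|].
        exact (equiv_sym _ _ (H _) _ _ Hxy).
Qed.

(** * Centralisation in points and in slices *)

Lemma slice_hom_of_point_comp (B : X) (A A' A'' : Points B) (g : Hom A' A'')
  (f : Hom A A') :
  slice_hom_of_point (g ∘ f) = slice_hom_of_point g ∘ slice_hom_of_point f.
Proof. now apply sig_ext. Qed.

Lemma slice_hom_of_point_assoc (B : X) (A A' A'' : Points B) (g : Hom A' A'')
  (f : Hom A A') (T : Slice B) (x : Hom T (slice_of_point A)) :
  slice_hom_of_point g ∘ (slice_hom_of_point f ∘ x) = slice_hom_of_point (g ∘ f) ∘ x.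
Proof. now rewrite slice_hom_of_point_comp, comp_assoc. Qed.

Lemma slice_hom_of_point_inj (B : X) (A A' : Points B) (f g : Hom A A') :
  slice_hom_of_point f = slice_hom_of_point g -> f = g.
Proof. intro e. apply sig_ext. exact (f_equal (@proj1_sig _ _) e). Qed.

Lemma free_point_slice (B : X) (T : Slice B) :
  exists (F : Points B) (i : Hom T (slice_of_point F)),
    (forall (A : Points B) (x : Hom T (slice_of_point A)),
       exists h : Hom F A, slice_hom_of_point h ∘ i = x) /\
    (forall (A : Points B) (h h' : Hom F A),
       slice_hom_of_point h ∘ i = slice_hom_of_point h' ∘ i -> h = h').
Proof.
  destruct (free_point (sl_map T)) as (F & i & Fi & Fex & Funi).
  exists F, (exist _ i Fi). split.
  - intros A x. destruct (Fex A (proj1_sig x) (proj2_sig x)) as [h Hh].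
    exists h. now apply sig_ext.
  - intros A h h' e. apply Funi. exact (f_equal (@proj1_sig _ _) e).
Qed.

(** The forgetful functor is a right adjoint, so the pullback in points is one in
    slices; the laws of the centraliser are tested on free points. *)
Lemma slice_centralise_of_points (B : X) (A : Points B) (G H : Graph A) :
  centralise G H ->
  centralise (slice_graph_of_points G) (slice_graph_of_points H).
Proof.
  intros (P & p & q & theta & Hpb & H1 & H2).
  exists (slice_of_point P), (slice_hom_of_point p), (slice_hom_of_point q),
    (slice_hom_of_point theta). cbn [gr1 gr2 gr_ob slice_graph_of_points].
  split; [split|split].
  - rewrite <- !slice_hom_of_point_comp. f_equal. apply Hpb.
  - intros T x y e.
    destruct (free_point_slice T) as (F & i & Fex & Funi).
    destruct (Fex _ x) as [x' <-]. destruct (Fex _ y) as [y' <-].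
    destruct (proj2 Hpb F x' y') as [u [[pu qu] _]].
    { apply Funi. now rewrite !slice_hom_of_point_comp, <- !comp_assoc. }
    exists (slice_hom_of_point u ∘ i). split.
    + now rewrite !comp_assoc, <- !slice_hom_of_point_comp, pu, qu.
    + intros v [pv qv]. destruct (Fex _ v) as [v' <-]. f_equal. f_equal.
      rewrite comp_assoc, <- slice_hom_of_point_comp in pv, qv.
      apply Funi in pv, qv. apply (pullback_ext Hpb); congruence.
  - intros T u e. destruct (free_point_slice T) as (F & i & Fex & Funi).
    destruct (Fex _ u) as [u' <-].
    repeat rewrite slice_hom_of_point_assoc in e; apply Funi in e.
    repeat rewrite slice_hom_of_point_assoc.
    rewrite H1; now rewrite !comp_assoc.
  - intros T u e. destruct (free_point_slice T) as (F & i & Fex & Funi).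
    destruct (Fex _ u) as [u' <-].
    repeat rewrite slice_hom_of_point_assoc in e; apply Funi in e.
    repeat rewrite slice_hom_of_point_assoc.
    rewrite H2; now rewrite !comp_assoc.
Qed.

(** The terminal object of the slice; its morphisms to a point are the sections. *)
Definition slice_unit (B : X) : Slice B := {| sl_ob := B; sl_map := idm B |}.

Definition section_hom (B : X) (A : Points B) :
  Hom (slice_unit B) (slice_of_point A) := exist _ (pt_sec A) (pt_split A).

Lemma section_hom_comp (B : X) (A A' : Points B) (h : Hom A A') :
  slice_hom_of_point h ∘ section_hom A = section_hom A'.
Proof. apply sig_ext. apply (proj2_sig h). Qed.

Lemma point_hom_of_slice_hom (B : X) (A A' : Points B)
  (h : Hom (slice_of_point A) (slice_of_point A')) :
  h ∘ section_hom A = section_hom A' ->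
  exists h' : Hom A A', slice_hom_of_point h' = h.
Proof.
  intro e. exists (exist _ (proj1_sig h)
    (conj (proj2_sig h) (f_equal (@proj1_sig _ _) e))).
  now apply sig_ext.
Qed.

Lemma points_centralise_intro (B : X) (A P : Points B) (G H : Graph A)
    (p : Hom (slice_of_point P) (slice_of_point (gr_ob G)))
    (q : Hom (slice_of_point P) (slice_of_point (gr_ob H)))
    (theta : Hom (slice_of_point P) (slice_of_point A)) :
  is_pullback (slice_hom_of_point (gr2 G)) (slice_hom_of_point (gr1 H)) p q ->
  (forall (T : Slice B) (u : Hom T (slice_of_point P)),
     slice_hom_of_point (gr1 H) ∘ (q ∘ u) = slice_hom_of_point (gr2 H) ∘ (q ∘ u) ->
     theta ∘ u = slice_hom_of_point (gr1 G) ∘ (p ∘ u)) ->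
  (forall (T : Slice B) (u : Hom T (slice_of_point P)),
     slice_hom_of_point (gr1 G) ∘ (p ∘ u) = slice_hom_of_point (gr2 G) ∘ (p ∘ u) ->
     theta ∘ u = slice_hom_of_point (gr2 H) ∘ (q ∘ u)) ->
  p ∘ section_hom P = section_hom (gr_ob G) ->
  q ∘ section_hom P = section_hom (gr_ob H) ->
  centralise G H.
Proof.
  intros Hpb H1 H2 ps qs.
  assert (et : theta ∘ section_hom P = section_hom A).
  { rewrite H1; rewrite ?ps, ?qs, !section_hom_comp; reflexivity. }
  destruct (point_hom_of_slice_hom (A := P) ps) as [p' <-].
  destruct (point_hom_of_slice_hom (A := P) qs) as [q' <-].
  destruct (point_hom_of_slice_hom (A := P) et) as [t' <-].
  exists P, p', q', t'. split; [split|split].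
  - apply slice_hom_of_point_inj. rewrite !slice_hom_of_point_comp. apply Hpb.
  - intros T x y e. apply (f_equal (@slice_hom_of_point _ _ _)) in e.
    rewrite !slice_hom_of_point_comp in e.
    destruct (proj2 Hpb _ _ _ e) as [u [[pu qu] Hu]].
    assert (eu : u ∘ section_hom T = section_hom P).
    { apply (pullback_ext Hpb).
      - now rewrite comp_assoc, pu, ps, section_hom_comp.
      - now rewrite comp_assoc, qu, qs, section_hom_comp. }
    destruct (point_hom_of_slice_hom (A := T) (A' := P) eu) as [u' <-].
    exists u'. split.
    + split; apply slice_hom_of_point_inj; now rewrite slice_hom_of_point_comp.
    + intros v [<- <-]. apply slice_hom_of_point_inj, Hu.
      now rewrite !slice_hom_of_point_comp.
  - intros T u e. apply slice_hom_of_point_inj.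
    rewrite !slice_hom_of_point_comp. apply H1.
    rewrite <- !slice_hom_of_point_comp. now f_equal.
  - intros T u e. apply slice_hom_of_point_inj.
    rewrite !slice_hom_of_point_comp. apply H2.
    rewrite <- !slice_hom_of_point_comp. now f_equal.
Qed.

(** The pullback acquires the section whose components are those of the two
    relations, and the centraliser preserves it, being [r] at the constant
    triple [(r, r, r)]. *)
Lemma points_centralise_of_slice (B : X) (A : Points B) (G H : Graph A) :
  centralise (slice_graph_of_points G) (slice_graph_of_points H) ->
  centralise G H.
Proof.
  intros ([P f] & p & q & theta & Hpb & H1 & H2).
  destruct (proj2 Hpb _ (section_hom (gr_ob G)) (section_hom (gr_ob H)))
    as [s [[ps qs] _]].
  { cbn [gr1 gr2 gr_ob slice_graph_of_points]. now rewrite !section_hom_comp. }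
  refine (@points_centralise_intro B A {| pt_ob := P; pt_map := f;
    pt_sec := proj1_sig s; pt_split := proj2_sig s |} G H p q theta Hpb H1 H2 _ _).
  - rewrite <- ps. now apply sig_ext.
  - rewrite <- qs. now apply sig_ext.
Qed.

Lemma slice_hom_of_point_pullback (E B : X) (p : Hom E B) (A A' : Points B)
  (h : Hom A A') :
  slice_hom_of_point (fmap (point_pullback L p) h)
  = fmap (slice_pullback L p) (slice_hom_of_point h).
Proof.
  apply sig_ext. cbn. apply pb_joint_mono; now rewrite ?pb1_lift, ?pb2_lift.
Qed.

Lemma slice_graph_of_points_pullback (E B : X) (p : Hom E B) (A : Points B)
  (G : Graph A) :
  slice_graph_of_points (graph_image (point_pullback L p) G)
  = graph_image (slice_pullback L p) (slice_graph_of_points G).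
Proof.
  unfold slice_graph_of_points at 1. cbn [gr1 gr2 gr_ob graph_image].
  now rewrite !slice_hom_of_point_pullback.
Qed.

(** Over [E] the centraliser is only needed to make the normalisations commute;
    the one over [B] comes from the base category. *)
Lemma basic_of_smith_is_huq : smith_is_huq X -> basic_fibration_condition L.
Proof.
  intros SH E B p A R S HR HS Hc.
  destruct (normalisation_exists (proj1 (proj1 (sl_equivalence _) HR)))
    as (M & m & Hm).
  destruct (normalisation_exists (proj1 (proj1 (sl_equivalence _) HS)))
    as (N & n & Hn).
  apply sl_centralise; [exact HS|].
  apply (SH _ _ _ (proj1 (sl_equivalence _) HR) (proj1 (sl_equivalence _) HS)
    M N m n Hm Hn).
  exact (sl_normalisations_commute HR HS Hm Hn Hc).
Qed.

Lemma C_bar_of_basic : basic_fibration_condition L -> condition_C_bar L.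
Proof.
  intros Hb E B p A R S HR HS Hc.
  apply points_centralise_of_slice, (Hb E B p).
  - apply sl_equivalence. exact (proj1 (pt_equivalence _) HR).
  - apply sl_equivalence. exact (proj1 (pt_equivalence _) HS).
  - rewrite <- !slice_graph_of_points_pullback.
    now apply slice_centralise_of_points.
Qed.
(** * Commutation in categories of points *)

(** The section of the relation is the section of [D] followed by reflexivity. *)
Lemma graph_in_points (B : X) (D : Points B) (G : Graph (pt_ob D)) :
  equivalence_relation G -> pt_map D ∘ gr1 G = pt_map D ∘ gr2 G ->
  exists G' : Graph D, pt_graph G' = G.
Proof.
  intros HG e. destruct (reflexivity_map HG) as (r & r1 & r2).
  assert (es : (pt_map D ∘ gr1 G) ∘ (r ∘ pt_sec D) = idm B).
  { rewrite <- comp_assoc, (reassoc r1), comp_id_l. apply pt_split. }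
  set (P := {| pt_ob := gr_ob G; pt_map := pt_map D ∘ gr1 G;
               pt_sec := r ∘ pt_sec D; pt_split := es |} : Points B).
  assert (h1 : pt_map D ∘ gr1 G = pt_map P /\ gr1 G ∘ pt_sec P = pt_sec D).
  { split; [reflexivity|]. simpl. now rewrite (reassoc r1), comp_id_l. }
  assert (h2 : pt_map D ∘ gr2 G = pt_map P /\ gr2 G ∘ pt_sec P = pt_sec D).
  { split; [now symmetry|]. simpl. now rewrite (reassoc r2), comp_id_l. }
  exists {| gr_ob := P : Points B; gr1 := exist _ (gr1 G) h1 : Hom P D;
            gr2 := exist _ (gr2 G) h2 : Hom P D |}.
  now destruct G.
Qed.

(** The product in points is the pullback over the base. The cooperator need not
    be assumed to be a morphism of points: the pullback is a point over [K] with
    kernel consisting of the elements [(0, b)], so [point_generated] shows that it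
    lies over [B]. *)
Lemma huq_points_iff (B : X) (K N A : Points B) (k : Hom K A) (l : Hom N A) :
  huq_commute k l <->
  exists phi : Hom (pb (fc_pullback L (pt_map K) (pt_map N))) (pt_ob A),
    (forall (T : X) (w : Hom T (pb (fc_pullback L (pt_map K) (pt_map N)))),
       pb2 _ ∘ w = pt_sec N ∘ (pt_map K ∘ (pb1 _ ∘ w)) ->
       phi ∘ w = pt_arrow k ∘ (pb1 _ ∘ w)) /\
    (forall (T : X) (w : Hom T (pb (fc_pullback L (pt_map K) (pt_map N)))),
       pb1 _ ∘ w = pt_sec K ∘ (pt_map N ∘ (pb2 _ ∘ w)) ->
       phi ∘ w = pt_arrow l ∘ (pb2 _ ∘ w)).
Proof.
  set (Q := fc_pullback L (pt_map K) (pt_map N)).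
  assert (es : pt_map K ∘ pt_sec K = pt_map N ∘ pt_sec N)
    by (now rewrite !pt_split).
  assert (ef : pt_map K ∘ pb1 Q ∘ pb_lift Q es = idm B)
    by (now rewrite <- comp_assoc, pb1_lift, pt_split).
  set (QP := {| pt_ob := pb Q; pt_map := pt_map K ∘ pb1 Q;
                pt_sec := pb_lift Q es; pt_split := ef |} : Points B).
  destruct (@pt_hom_exists B QP K (pb1 Q)) as [p Hp];
    [reflexivity | apply pb1_lift |].
  destruct (@pt_hom_exists B QP N (pb2 Q)) as [q Hq];
    [symmetry; apply pb_square | apply pb2_lift |].
  assert (ei : pt_map K ∘ idm _ = pt_map N ∘ (pt_sec N ∘ pt_map K))
    by (now rewrite pt_map_sec, comp_id_r).
  assert (ej : pt_map K ∘ (pt_sec K ∘ pt_map N) = pt_map N ∘ idm _)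
    by (now rewrite pt_map_sec, comp_id_r).
  destruct (@pt_hom_exists B K QP (pb_lift Q ei)) as [i Hi].
  { change (pt_map K ∘ pb1 Q ∘ pb_lift Q ei = pt_map K).
    now rewrite <- comp_assoc, pb1_lift, comp_id_r. }
  { apply pb_joint_mono; change (pt_sec QP) with (pb_lift Q es);
      rewrite ?(pb1_lift Q es), ?(pb2_lift Q es); unfold Q.
    - now rewrite pb1_lift_comp, comp_id_l.
    - now rewrite pb2_lift_comp, <- comp_assoc, pt_split, comp_id_r. }
  destruct (@pt_hom_exists B N QP (pb_lift Q ej)) as [j Hj].
  { change (pt_map K ∘ pb1 Q ∘ pb_lift Q ej = pt_map N).
    now rewrite <- comp_assoc, pb1_lift, pt_map_sec. }
  { apply pb_joint_mono; change (pt_sec QP) with (pb_lift Q es);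
      rewrite ?(pb1_lift Q es), ?(pb2_lift Q es); unfold Q.
    - now rewrite pb1_lift_comp, <- comp_assoc, pt_split, comp_id_r.
    - now rewrite pb2_lift_comp, comp_id_l. }
  assert (pi : p ∘ i = idm K)
    by (apply pt_arrow_inj; rewrite pt_arrow_comp, Hp, Hi; apply pb1_lift).
  assert (qi : is_zero_mor (q ∘ i))
    by (apply pt_zero_mor_iff; rewrite pt_arrow_comp, Hq, Hi; apply pb2_lift).
  assert (pj : is_zero_mor (p ∘ j))
    by (apply pt_zero_mor_iff; rewrite pt_arrow_comp, Hp, Hj; apply pb1_lift).
  assert (qj : q ∘ j = idm N)
    by (apply pt_arrow_inj; rewrite pt_arrow_comp, Hq, Hj; apply pb2_lift).
  assert (wi : forall T (w : Hom T (pb Q)),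
    pb2 Q ∘ w = pt_sec N ∘ (pt_map K ∘ (pb1 Q ∘ w)) ->
    w = pt_arrow i ∘ (pb1 Q ∘ w)).
  { intros T w e. rewrite Hi. apply pb_joint_mono; unfold Q.
    - now rewrite pb1_lift_comp, comp_id_l.
    - now rewrite pb2_lift_comp, <- comp_assoc. }
  assert (wj : forall T (w : Hom T (pb Q)),
    pb1 Q ∘ w = pt_sec K ∘ (pt_map N ∘ (pb2 Q ∘ w)) ->
    w = pt_arrow j ∘ (pb2 Q ∘ w)).
  { intros T w e. rewrite Hj. apply pb_joint_mono; unfold Q.
    - now rewrite pb1_lift_comp, <- comp_assoc.
    - now rewrite pb2_lift_comp, comp_id_l. }
  split.
  - intros (P & p' & q' & i' & j' & phi & HP' & [pi' qi'] & [pj' qj'] & <- & <-).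
    destruct (HP' QP p q) as [u [[pu qu] _]].
    assert (Hext : forall T (a b : Hom T P),
      p' ∘ a = p' ∘ b -> q' ∘ a = q' ∘ b -> a = b).
    { intros T a b e1 e2. destruct (HP' T (p' ∘ b) (q' ∘ b)) as [w [_ Hw]].
      now rewrite <- (Hw a (conj e1 e2)), <- (Hw b (conj eq_refl eq_refl)). }
    assert (Hzero : forall (C D : Points B) (f g : Hom C D),
      is_zero_mor f -> is_zero_mor g -> f = g).
    { intros C D f g Hf Hg. apply pt_zero_mor_iff in Hf, Hg.
      apply pt_arrow_inj. congruence. }
    assert (ui : u ∘ i = i').
    { apply Hext; rewrite comp_assoc, ?pu, ?qu; [congruence|].
      now apply Hzero. }
    assert (uj : u ∘ j = j').
    { apply Hext; rewrite comp_assoc, ?pu, ?qu; [|congruence].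
      now apply Hzero. }
    exists (pt_arrow (phi ∘ u)). split; intros T w e.
    + rewrite (wi T w e) at 1. rewrite comp_assoc. f_equal.
      now rewrite <- ui, comp_assoc.
    + rewrite (wj T w e) at 1. rewrite comp_assoc. f_equal.
      now rewrite <- uj, comp_assoc.
  - intros (phi & H1 & H2).
    assert (ki : phi ∘ pt_arrow i = pt_arrow k).
    { rewrite H1; rewrite Hi, pb1_lift, ?pb2_lift; now rewrite ?comp_id_r. }
    assert (lj : phi ∘ pt_arrow j = pt_arrow l).
    { rewrite H2; rewrite Hj, pb2_lift, ?pb1_lift; now rewrite ?comp_id_r. }
    destruct (@pt_hom_exists B QP A phi) as [phi' Hphi].
    { change (pt_map A ∘ phi = pt_map K ∘ pb1 Q).
      rewrite <- (comp_id_r (pt_map A ∘ phi)), <- (comp_id_r (pt_map K ∘ pb1 Q)).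
      apply (@point_generated (pb Q) (pt_ob K) (pb1 Q) (pb_lift Q ei)
        (fun T a => (pt_map A ∘ phi) ∘ a = (pt_map K ∘ pb1 Q) ∘ a)).
      - apply pb1_lift.
      - apply representable_equal.
      - rewrite <- Hi, <- !comp_assoc, ki, Hi, pb1_lift, comp_id_r.
        apply (proj2_sig k).
      - intros T a e. rewrite <- !comp_assoc, H2.
        + rewrite pt_arrow_map_comp. unfold Q. now rewrite pb_square_comp.
        + unfold Q at 2. rewrite <- pb_square_comp. fold Q.
          now rewrite e, !zero_r. }
    { change (phi ∘ pb_lift Q es = pt_sec A).
      rewrite H1; rewrite pb1_lift.
      - apply (proj2_sig k).
      - now rewrite pb2_lift, pt_split, comp_id_r. }
    exists QP, p, q, i, j, phi'. repeat split; auto.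
    + intros T x y.
      assert (e : pt_map K ∘ pt_arrow x = pt_map N ∘ pt_arrow y).
      { exact (eq_trans (proj1 (proj2_sig x)) (eq_sym (proj1 (proj2_sig y)))). }
      destruct (@pt_hom_exists B T QP (pb_lift Q e)) as [u Hu].
      { change (pt_map K ∘ pb1 Q ∘ pb_lift Q e = pt_map T).
        rewrite <- comp_assoc, pb1_lift. apply (proj2_sig x). }
      { change (pt_sec QP) with (pb_lift Q es).
        apply pb_joint_mono; rewrite ?(pb1_lift Q es), ?(pb2_lift Q es); unfold Q.
        - rewrite pb1_lift_comp. apply (proj2_sig x).
        - rewrite pb2_lift_comp. apply (proj2_sig y). }
      exists u. split.
      * split; apply pt_arrow_inj; rewrite pt_arrow_comp, Hu, ?Hp, ?Hq;
          [apply pb1_lift | apply pb2_lift].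
      * intros v [<- <-]. apply pt_arrow_inj. rewrite Hu.
        apply pb_joint_mono; rewrite ?pb1_lift, ?pb2_lift, pt_arrow_comp;
          now rewrite ?Hp, ?Hq.
    + apply pt_arrow_inj. now rewrite pt_arrow_comp, Hphi.
    + apply pt_arrow_inj. now rewrite pt_arrow_comp, Hphi.
Qed.

(** * Change of base for points, and commutation from Smith is Huq *)

(** A kernel in points is also a kernel in the base category, for elements with
    arbitrary domain: pass to the free point. *)
Lemma pt_kernel_lift (B : X) (A A' K : Points B) (f : Hom A A') (k : Hom K A)
  (T : X) (x : Hom T (pt_ob A)) :
  is_kernel f k -> pt_arrow f ∘ x = pt_sec A' ∘ (pt_map A ∘ x) ->
  exists c : Hom T (pt_ob K), pt_arrow k ∘ c = x.
Proof.
  intros [_ Hk] e.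
  destruct (free_point (pt_map A ∘ x)) as (F & i & Fi & Fex & Funi).
  destruct (Fex A x eq_refl) as [x' Hx].
  assert (Hz : is_zero_mor (f ∘ x')).
  { destruct (Fex A' (pt_sec A' ∘ (pt_map A ∘ x))) as [z' Hz'].
    - apply pt_map_sec.
    - destruct (@pt_hom_exists B F A' (pt_sec A' ∘ pt_map F)) as [o Ho].
      + now rewrite comp_assoc, pt_split, comp_id_l.
      + now rewrite <- comp_assoc, pt_split, comp_id_r.
      + apply pt_zero_mor_iff. rewrite <- Ho. f_equal. apply Funi.
        rewrite pt_arrow_comp, Ho, <- !comp_assoc. congruence. }
  destruct (Hk F x' Hz) as [u [<- _]].
  exists (pt_arrow u ∘ i). now rewrite comp_assoc, <- pt_arrow_comp.
Qed.

(** The projection from the pulled back point. Together with its structure map it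
    is all that is needed of the chosen pullback. *)
Definition pt_proj (E B : X) (p : Hom E B) (A : Points B) :
  Hom (pt_ob (point_pullback L p A)) (pt_ob A) := pb2 (fc_pullback L p (pt_map A)).

Section PointPullback.
Variables (E B : X) (p : Hom E B).

Lemma pt_pullback_square (A : Points B) (T : X)
  (x : Hom T (pt_ob (point_pullback L p A))) :
  pt_map A ∘ (pt_proj p A ∘ x) = p ∘ (pt_map (point_pullback L p A) ∘ x).
Proof. symmetry. apply pb_square_comp. Qed.

Lemma pt_pullback_ext (A : Points B) (T : X)
  (x y : Hom T (pt_ob (point_pullback L p A))) :
  pt_map (point_pullback L p A) ∘ x = pt_map (point_pullback L p A) ∘ y ->
  pt_proj p A ∘ x = pt_proj p A ∘ y -> x = y.
Proof. apply pb_joint_mono. Qed.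

Lemma pt_pullback_lift (A : Points B) (T : X) (x : Hom T E)
  (y : Hom T (pt_ob A)) : p ∘ x = pt_map A ∘ y ->
  exists a : Hom T (pt_ob (point_pullback L p A)),
    pt_map (point_pullback L p A) ∘ a = x /\ pt_proj p A ∘ a = y.
Proof.
  intro e. exists (pb_lift _ e). split; [apply pb1_lift | apply pb2_lift].
Qed.

Lemma pt_proj_sec (A : Points B) (T : X) (x : Hom T E) :
  pt_proj p A ∘ (pt_sec (point_pullback L p A) ∘ x) = pt_sec A ∘ (p ∘ x).
Proof. rewrite (comp_assoc _ p). apply pb2_lift_comp. Qed.

Lemma pt_proj_hom (A A' : Points B) (h : Hom A A') (T : X)
  (x : Hom T (pt_ob (point_pullback L p A))) :
  pt_proj p A' ∘ (pt_arrow (fmap (point_pullback L p) h) ∘ x)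
  = pt_arrow h ∘ (pt_proj p A ∘ x).
Proof. rewrite (comp_assoc _ (pt_proj p A)). apply pb2_lift_comp. Qed.

End PointPullback.

(** Elements [x] and [y] of the normalisations in the base category lie in [K] and
    [N] over zero, so a cooperator of the pulled back subobjects can be
    evaluated at them and makes the normalisations commute. With the resulting
    centraliser [theta] the cooperator over [B] is [(a, b) |-> theta(k a, 0, l b)],
    where [0] is the zero of the fibre in which [a] and [b] lie. *)
Lemma C_of_smith_is_huq : smith_is_huq X -> condition_C L.
Proof.
  intros SH E B p A K N k l (R & HR & kap & Hkap & ->) (S & HS & lam & Hlam & ->) Hc.
  apply huq_points_iff in Hc as (phi & Hphi1 & Hphi2).
  apply pt_equivalence in HR, HS.
  destruct (normalisation_exists (proj1 HR)) as (M & m & Hm).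
  destruct (normalisation_exists (proj1 HS)) as (M' & n & Hn).
  assert (zkap := proj1 (pt_zero_mor_iff _) (proj1 Hkap)).
  assert (zlam := proj1 (pt_zero_mor_iff _) (proj1 Hlam)).
  rewrite pt_arrow_comp in zkap, zlam.
  assert (Hmn : huq_commute m n).
  { destruct (proj2 (proj1 (normalisation_iff m (proj1 HR)) Hm) M m) as [_ Hr].
    destruct Hr as [r [r1 r2]]; [now exists (idm M); rewrite comp_id_r|].
    destruct (proj2 (proj1 (normalisation_iff n (proj1 HS)) Hn) M' n) as [_ Hs].
    destruct Hs as [s [s1 s2]]; [now exists (idm M'); rewrite comp_id_r|].
    simpl in r, r1, r2, s, s1, s2.
    assert (mr : pt_map (gr_ob R) ∘ r = zero M B)
      by (rewrite <- (pt_arrow_map_comp (gr1 R)), r1; apply zero_r).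
    assert (ms : pt_map (gr_ob S) ∘ s = zero M' B)
      by (rewrite <- (pt_arrow_map_comp (gr1 S)), s1; apply zero_r).
    (* [r] and [s] are the kernels of the first projections of [R] and [S]; they
       factor through [K] and [N]. *)
    destruct (@pt_kernel_lift _ _ _ _ _ _ _ r Hkap) as [c Hc];
      [now rewrite mr, r1, zero_r|].
    destruct (@pt_kernel_lift _ _ _ _ _ _ _ s Hlam) as [d Hd];
      [now rewrite ms, s1, zero_r|].
    assert (mc : pt_map K ∘ c = zero M B)
      by (now rewrite <- (pt_arrow_map_comp kap), Hc).
    assert (md : pt_map N ∘ d = zero M' B)
      by (now rewrite <- (pt_arrow_map_comp lam), Hd).
    destruct (@pt_pullback_lift E B p K (prod M M') (zero _ _) (c ∘ pr1 M M'))
      as (a & a1 & a2); [now rewrite (reassoc mc), zero_l, zero_r|].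
    destruct (@pt_pullback_lift E B p N (prod M M') (zero _ _) (d ∘ pr2 M M'))
      as (b & b1 & b2); [now rewrite (reassoc md), zero_l, zero_r|].
    set (w := pb_lift (fc_pullback L (pt_map (point_pullback L p K))
      (pt_map (point_pullback L p N))) (eq_trans a1 (eq_sym b1))).
    apply huq_commute_iff. exists (pt_proj p A ∘ (phi ∘ w)).
    split; intros T x; rewrite <- !comp_assoc.
    - rewrite Hphi1; unfold w; rewrite !pb1_lift_comp, ?pb2_lift_comp.
      + rewrite pt_proj_hom, (reassoc a2), <- comp_assoc, pr1_pair.
        rewrite pt_arrow_comp, <- comp_assoc, (reassoc Hc), (reassoc r2).
        reflexivity.
      + rewrite (reassoc a1), zero_l, zero_r. apply pt_pullback_ext.
        * now rewrite (reassoc b1), zero_l, zero_r.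
        * now rewrite (reassoc b2), <- comp_assoc, pr2_pair, !zero_r.
    - rewrite Hphi2; unfold w; rewrite ?pb1_lift_comp, !pb2_lift_comp.
      + rewrite pt_proj_hom, (reassoc b2), <- comp_assoc, pr2_pair.
        rewrite pt_arrow_comp, <- comp_assoc, (reassoc Hd), (reassoc s2).
        reflexivity.
      + rewrite (reassoc b1), zero_l, zero_r. apply pt_pullback_ext.
        * now rewrite (reassoc a1), zero_l, zero_r.
        * now rewrite (reassoc a2), <- comp_assoc, pr1_pair, !zero_r. }
  destruct (SH _ _ _ HR HS M M' m n Hm Hn Hmn)
    as (P & p' & q' & theta & Hpb & H1 & H2).
  destruct (symmetry_map HR) as (s & s1 & s2).
  simpl in p', q', H1, H2, s, s1, s2, Hpb.
  apply huq_points_iff.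
  set (Q := fc_pullback L (pt_map K) (pt_map N)).
  (* [s] reverses [R], turning the pair [(0, k a)] into [(k a, 0)]. *)
  destruct (proj2 Hpb (pb Q) (s ∘ (pt_arrow kap ∘ pb1 Q)) (pt_arrow lam ∘ pb2 Q))
    as [u [[pu qu] _]].
  { rewrite (reassoc s2), (reassoc zkap), (reassoc zlam), <- !comp_assoc.
    f_equal. apply pb_square. }
  exists (theta ∘ u). split; intros T w e; rewrite <- comp_assoc.
  - rewrite H1.
    + rewrite (reassoc pu), <- comp_assoc, (reassoc s1), <- comp_assoc.
      now rewrite pt_arrow_comp, <- comp_assoc.
    + rewrite (reassoc qu), <- comp_assoc. fold Q in e. rewrite e.
      now rewrite !pt_arrow_sec_comp.
  - rewrite H2.
    + rewrite (reassoc qu), <- comp_assoc.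
      now rewrite pt_arrow_comp, <- comp_assoc.
    + rewrite (reassoc pu), <- !comp_assoc. fold Q in e. rewrite e.
      rewrite (reassoc s1), (reassoc s2).
      now rewrite !pt_arrow_sec_comp.
Qed.

(** * Equivalence relations as normal subobjects of the square *)

(** The relations used on the square of an object and on the point of triples
    are of this form. *)
Lemma fibrewise_inverse_image (B A : X) (D : Points B) (R : Graph A)
    (g : Hom (pt_ob D) A) :
  equivalence_relation R ->
  exists G : Graph D, equivalence_relation G /\
    forall (T : X) (x y : Hom T (pt_ob D)),
      related (pt_graph G) x y <->
      pt_map D ∘ x = pt_map D ∘ y /\ related R (g ∘ x) (g ∘ y).
Proof.
  intros [HR HRe].
  set (D' := pt_ob D).
  destruct (@graph_of_representable D' (fun T v =>
    (pt_map D ∘ pr1 D' D') ∘ v = (pt_map D ∘ pr2 D' D') ∘ v /\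
    related R ((g ∘ pr1 D' D') ∘ v) ((g ∘ pr2 D' D') ∘ v))) as (G0 & HG0 & HG).
  { apply representable_and; [apply representable_equal|].
    now apply representable_related. }
  assert (HG' : forall (T : X) (x y : Hom T D'),
    related G0 x y <-> pt_map D ∘ x = pt_map D ∘ y /\ related R (g ∘ x) (g ∘ y)).
  { intros T x y. rewrite HG, <- !comp_assoc, !pr1_pair, !pr2_pair. reflexivity. }
  clear HG.
  assert (Heq : equivalence_relation G0).
  { split; [exact HG0|]. intro T. constructor.
    - intro x. apply HG'. split; [reflexivity | apply (equiv_refl _ _ (HRe T))].
    - intros x y z' Hxy Hyz. apply HG' in Hxy as [e1 e2], Hyz as [e3 e4].
      apply HG'. split; [congruence|]. exact (equiv_trans _ _ (HRe T) _ _ _ e2 e4).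
    - intros x y Hxy. apply HG' in Hxy as [e1 e2]. apply HG'.
      split; [congruence|]. exact (equiv_sym _ _ (HRe T) _ _ e2). }
  destruct (graph_in_points Heq) as [G HGG].
  { apply (proj1 (HG' _ _ _)). exists (idm _). now rewrite !comp_id_r. }
  exists G. split; [|now rewrite HGG].
  apply pt_equivalence. now rewrite HGG.
Qed.

Definition square_point (A : X) : Points A :=
  {| pt_ob := prod A A; pt_map := pr1 A A; pt_sec := pair (idm A) (idm A);
     pt_split := pr1_pair _ _ |}.

Definition relation_point (A : X) (R : Graph A) (r : Hom A (gr_ob R))
  (e : gr1 R ∘ r = idm A) : Points A :=
  {| pt_ob := gr_ob R; pt_map := gr1 R; pt_sec := r; pt_split := e |}.

(** The equivalence relation on [A × A] in points which relates [(x, y)] to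
    [(x, z)] when [y R z] has this subobject as its normalisation: the zero of the
    fibre over [x] is [(x, x)], and it is related to [(x, z)] when [x R z]. *)
Lemma relation_point_normal (A : X) (R : Graph A) (r : Hom A (gr_ob R))
    (e1 : gr1 R ∘ r = idm A) (e2 : gr2 R ∘ r = idm A) :
  equivalence_relation R ->
  exists k : Hom (relation_point e1) (square_point A),
    pt_arrow k = pair (gr1 R) (gr2 R) /\ normal_subobject k.
Proof.
  intro HR.
  destruct (@pt_hom_exists A (relation_point e1) (square_point A)
    (pair (gr1 R) (gr2 R))) as [k Hk].
  { apply pr1_pair. }
  { simpl. now rewrite pair_comp, e1, e2. }
  exists k. split; [exact Hk|].
  destruct (@fibrewise_inverse_image A A (square_point A) R (pr2 A A) HR)
    as (G & HG & Hrel).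
  exists G. split; [exact HG|].
  (* The facts on [G] are restated with codomain [A × A], since rewriting does
     not see through the definition of [square_point]. *)
  set (g1 := pt_arrow (gr1 G) : Hom (pt_ob (gr_ob G)) (prod A A)).
  set (g2 := pt_arrow (gr2 G) : Hom (pt_ob (gr_ob G)) (prod A A)).
  assert (HGm : forall T (x y : Hom T (pt_ob (gr_ob G))),
    g1 ∘ x = g1 ∘ y -> g2 ∘ x = g2 ∘ y -> x = y)
    by exact (proj1 (proj1 (pt_equivalence G) HG)).
  assert (g1map : pr1 A A ∘ g1 = pt_map (gr_ob G)) by exact (pt_arrow_map (gr1 G)).
  assert (g1sec : g1 ∘ pt_sec (gr_ob G) = pair (idm A) (idm A))
    by exact (pt_arrow_sec (gr1 G)).
  assert (g2sec : g2 ∘ pt_sec (gr_ob G) = pair (idm A) (idm A))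
    by exact (pt_arrow_sec (gr2 G)).
  assert (Hrel' : forall T (x y : Hom T (prod A A)),
    (exists c : Hom T (pt_ob (gr_ob G)), g1 ∘ c = x /\ g2 ∘ c = y) <->
    pr1 A A ∘ x = pr1 A A ∘ y /\ related R (pr2 A A ∘ x) (pr2 A A ∘ y))
    by exact Hrel.
  destruct (proj2 (Hrel' _ (pair (gr1 R) (gr1 R)) (pair (gr1 R) (gr2 R))))
    as [c [c1 c2]].
  { rewrite !pr1_pair, !pr2_pair. split; [reflexivity|].
    exists (idm _). now rewrite !comp_id_r. }
  destruct (@pt_hom_exists A (relation_point e1) (gr_ob G) c) as [kap Hkap].
  { change (pt_map (gr_ob G) ∘ c = gr1 R).
    rewrite <- g1map, <- comp_assoc, c1. apply pr1_pair. }
  { change (c ∘ r = pt_sec (gr_ob G)). apply HGm.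
    - now rewrite (reassoc c1), pair_comp, e1, g1sec.
    - now rewrite (reassoc c2), pair_comp, e1, e2, g2sec. }
  assert (Hg1 : forall T (h : Hom T (gr_ob G)), g1 ∘ pt_arrow h = pt_arrow (gr1 G ∘ h))
    by reflexivity.
  assert (Hg2 : forall T (h : Hom T (gr_ob G)), g2 ∘ pt_arrow h = pt_arrow (gr2 G ∘ h))
    by reflexivity.
  exists kap. split; [split|].
  - apply pt_zero_mor_iff. rewrite <- Hg1, Hkap.
    change (g1 ∘ c = pair (idm A) (idm A) ∘ gr1 R).
    now rewrite c1, pair_comp, comp_id_l.
  - intros T h Hz. apply pt_zero_mor_iff in Hz. rewrite <- Hg1 in Hz.
    change (g1 ∘ pt_arrow h = pair (idm A) (idm A) ∘ pt_map T) in Hz.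
    rewrite pair_comp, comp_id_l in Hz.
    destruct (proj1 (Hrel' _ (g1 ∘ pt_arrow h) (g2 ∘ pt_arrow h)))
      as [h1 [u [u1 u2]]]; [now exists (pt_arrow h)|].
    rewrite Hz, pr1_pair in h1. rewrite Hz, pr2_pair in u1.
    destruct (@pt_hom_exists A T (relation_point e1) u) as [u' Hu'].
    { exact u1. }
    { change (u ∘ pt_sec T = r). apply (proj1 HR).
      - now rewrite (reassoc u1), e1, pt_split.
      - now rewrite (reassoc u2), <- comp_assoc, <- comp_assoc, pt_arrow_sec, g2sec,
          pr2_pair, e2. }
    assert (Hh : g2 ∘ pt_arrow h = pair (gr1 R ∘ u) (gr2 R ∘ u)).
    { apply prod_ext; rewrite ?pr1_pair, ?pr2_pair; congruence. }
    exists u'. split.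
    + apply pt_arrow_inj. rewrite pt_arrow_comp, Hkap, Hu'.
      change (c ∘ u = pt_arrow h). apply HGm.
      * now rewrite (reassoc c1), pair_comp, Hz, u1.
      * now rewrite (reassoc c2), pair_comp, Hh.
    + intros v <-. apply pt_arrow_inj. rewrite Hu'.
      rewrite pt_arrow_comp, Hkap in Hh.
      change (g2 ∘ (c ∘ pt_arrow v) = pair (gr1 R ∘ u) (gr2 R ∘ u)) in Hh.
      rewrite (reassoc c2), pair_comp in Hh.
      apply (proj1 HR).
      * apply (f_equal (comp (pr1 A A))) in Hh. now rewrite !pr1_pair in Hh.
      * apply (f_equal (comp (pr2 A A))) in Hh. now rewrite !pr2_pair in Hh.
  - apply pt_arrow_inj. rewrite <- Hg2, Hkap, Hk. symmetry. exact c2.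
Qed.

(** The kernel of the point [R] over [A] is the normalisation of [R], so a
    cooperator [phi] of the normalisations gives [(0, phi)] for the pulled back
    subobjects of [A × A]. Conversely a cooperator over [A] sends
    [((y, x), (y, z))] to some [(y, w)], and [theta(x, y, z)] is this [w]. *)
Lemma smith_is_huq_of_C : condition_C L -> smith_is_huq X.
Proof.
  intros C A R S HR HS M N m n Hm Hn Hmn.
  destruct (reflexivity_map HR) as (r & r1 & r2).
  destruct (reflexivity_map HS) as (s & s1 & s2).
  apply (normalisation_iff _ (proj1 HR)) in Hm.
  apply (normalisation_iff _ (proj1 HS)) in Hn.
  destruct (relation_point_normal r1 r2 HR) as (k & Hk & kn).
  destruct (relation_point_normal s1 s2 HS) as (l & Hl & ln).
  set (p := from0 Z A).
  assert (Hc : huq_commute k l).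
  { apply (C _ _ p _ _ _ k l kn ln). apply huq_points_iff.
    set (Q := fc_pullback L (pt_map (point_pullback L p (relation_point r1)))
      (pt_map (point_pullback L p (relation_point s1)))).
    apply huq_commute_iff in Hmn as (phi & Hphi1 & Hphi2).
    set (a := pt_proj p (relation_point r1) ∘ pb1 Q : Hom (pb Q) (gr_ob R)).
    set (b := pt_proj p (relation_point s1) ∘ pb2 Q : Hom (pb Q) (gr_ob S)).
    assert (a1 : gr1 R ∘ a = zero _ _).
    { exact (eq_trans (pt_pullback_square (pb1 Q)) (from0_zero _ _)). }
    assert (b1 : gr1 S ∘ b = zero _ _).
    { exact (eq_trans (pt_pullback_square (pb2 Q)) (from0_zero _ _)). }
    destruct (proj1 (proj2 Hm _ (gr2 R ∘ a))) as [x Hx]; [now exists a|].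
    destruct (proj1 (proj2 Hn _ (gr2 S ∘ b))) as [y Hy]; [now exists b|].
    destruct (@pt_pullback_lift _ _ p (square_point A) (pb Q) (to0 Z _)
      (pair (zero _ _) (phi ∘ pair x y))) as (f & f1 & f2).
    { simpl. rewrite pr1_pair. reflexivity. }
    exists f. split; intros T w e.
    - apply pt_pullback_ext; [apply to0_unique|].
      rewrite pt_proj_hom, (reassoc f2), Hk, (comp_assoc _ (pb1 Q)).
      change (pair (zero _ _) (phi ∘ pair x y) ∘ w
              = pair (gr1 R) (gr2 R) ∘ (a ∘ w)).
      rewrite !pair_comp, zero_l, (reassoc a1), zero_l.
      f_equal. rewrite <- comp_assoc, pair_comp.
      assert (yw : y ∘ w = zero _ _).
      { apply (proj1 Hn). rewrite (reassoc Hy), zero_r. unfold b.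
        rewrite <- !comp_assoc. unfold Q in *. rewrite e, pt_proj_sec. simpl.
        now rewrite (reassoc s2), comp_id_l, from0_zero. }
      now rewrite yw, Hphi1, (reassoc Hx), <- comp_assoc.
    - apply pt_pullback_ext; [apply to0_unique|].
      rewrite pt_proj_hom, (reassoc f2), Hl, (comp_assoc _ (pb2 Q)).
      change (pair (zero _ _) (phi ∘ pair x y) ∘ w
              = pair (gr1 S) (gr2 S) ∘ (b ∘ w)).
      rewrite !pair_comp, zero_l, (reassoc b1), zero_l.
      f_equal. rewrite <- comp_assoc, pair_comp.
      assert (xw : x ∘ w = zero _ _).
      { apply (proj1 Hm). rewrite (reassoc Hx), zero_r. unfold a.
        rewrite <- !comp_assoc. unfold Q in *. rewrite e, pt_proj_sec. simpl.
        now rewrite (reassoc r2), comp_id_l, from0_zero. }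
      now rewrite xw, Hphi2, (reassoc Hy), <- comp_assoc. }
  apply huq_points_iff in Hc as (phi & H1 & H2). simpl in phi, H1, H2.
  destruct (symmetry_map HR) as (t & t1 & t2).
  set (P := fc_pullback L (gr2 R) (gr1 S)).
  assert (ew : gr1 R ∘ (t ∘ pb1 P) = gr1 S ∘ pb2 P)
    by (rewrite (reassoc t1); apply pb_square).
  set (Q := fc_pullback L (gr1 R) (gr1 S)) in *.
  exists (pb P), (pb1 P), (pb2 P), (pr2 A A ∘ (phi ∘ pb_lift Q ew)).
  split; [apply Pullback_is_pullback|split].
  - intros T u e. rewrite <- !comp_assoc, H1; unfold Q;
      rewrite ?pb2_lift_comp, ?pb1_lift_comp.
    + rewrite Hk, (reassoc (pr2_pair _ _)), <- comp_assoc.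
      now rewrite (reassoc t2).
    + apply (proj1 HS); rewrite ?(reassoc s1), ?(reassoc s2), comp_id_l, <- comp_assoc,
        (reassoc t1); unfold P in *; rewrite pb_square_comp; congruence.
  - intros T u e. rewrite <- !comp_assoc, H2; unfold Q;
      rewrite ?pb2_lift_comp, ?pb1_lift_comp.
    + now rewrite Hl, (reassoc (pr2_pair _ _)).
    + unfold P in *. rewrite <- comp_assoc, <- pb_square_comp.
      apply (proj1 HR); rewrite ?(reassoc r1), ?(reassoc r2), comp_id_l,
        ?(reassoc t1), ?(reassoc t2); congruence.
Qed.

(** * From reflection of centralisation to Smith is Huq *)

(** The point over [A] whose elements are the triples [(x, y, z)] with [x R y] and
    [y S z], projected to [x] and with section [(x, x, x)]. *)
Lemma triple_point (A : X) (R S : Graph A) :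
  equivalence_relation R -> equivalence_relation S ->
  exists (D : Points A) (t2 t3 : Hom (pt_ob D) A),
    (forall T (x : Hom T (pt_ob D)),
       related R (pt_map D ∘ x) (t2 ∘ x) /\ related S (t2 ∘ x) (t3 ∘ x)) /\
    (forall T (x y z : Hom T A), related R x y -> related S y z ->
       exists t : Hom T (pt_ob D), pt_map D ∘ t = x /\ t2 ∘ t = y /\ t3 ∘ t = z) /\
    (forall T (t t' : Hom T (pt_ob D)), pt_map D ∘ t = pt_map D ∘ t' ->
       t2 ∘ t = t2 ∘ t' -> t3 ∘ t = t3 ∘ t' -> t = t').
Proof.
  intros HR HS.
  destruct (reflexivity_map HR) as (r & r1 & r2).
  destruct (reflexivity_map HS) as (s & s1 & s2).
  set (P := fc_pullback L (gr2 R) (gr1 S)).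
  assert (es : gr2 R ∘ r = gr1 S ∘ s) by congruence.
  assert (em : (gr1 R ∘ pb1 P) ∘ pb_lift P es = idm A)
    by (now rewrite <- comp_assoc, pb1_lift).
  exists {| pt_ob := pb P; pt_map := gr1 R ∘ pb1 P; pt_sec := pb_lift P es;
            pt_split := em |}, (gr2 R ∘ pb1 P), (gr2 S ∘ pb2 P).
  simpl. split; [|split].
  - intros T x. split.
    + exists (pb1 P ∘ x). now rewrite !comp_assoc.
    + exists (pb2 P ∘ x). rewrite (pb_square P), !comp_assoc. easy.
  - intros T x y z' [a [a1 a2]] [b [b1 b2]].
    assert (e : gr2 R ∘ a = gr1 S ∘ b) by congruence.
    exists (pb_lift P e). rewrite <- !comp_assoc, pb1_lift, pb2_lift. easy.
  - intros T t t' e1 e2 e3. rewrite <- !comp_assoc in e1, e2, e3.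
    apply pb_joint_mono; [now apply (proj1 HR)|]. fold P.
    apply (proj1 HS); [|exact e3]. unfold P in *.
    now rewrite <- !pb_square_comp.
Qed.

Lemma discrete_equivalence (A : X) :
  equivalence_relation {| gr_ob := A; gr1 := idm A; gr2 := idm A |}.
Proof.
  split.
  - intros T a b. simpl. now rewrite !comp_id_l.
  - intro T. constructor.
    + intro x. exists x. simpl. now rewrite comp_id_l.
    + intros x y z' [a [a1 a2]] [b [b1 b2]]. exists a. simpl in *.
      rewrite comp_id_l in *. split; congruence.
    + intros x y [a [a1 a2]]. exists a. easy.
Qed.

Lemma discrete_related (A T : X) (x y : Hom T A) :
  related {| gr_ob := A; gr1 := idm A; gr2 := idm A |} x y <-> x = y.
Proof.
  split.
  - intros [a [<- <-]]. reflexivity.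
  - intros ->. exists y. simpl. now rewrite comp_id_l.
Qed.

(** If the zero class [V] of [R] commutes with the whole of [N], by [psi], then
    [x] and [y] are [R]-related exactly when [x = psi(d, y)] for some [d] in [V],
    which is then unique; additively, [d] is the difference of [x] and [y]. The
    comparison [(d, y) |-> (psi(d, y), y)] from [V × N] to [R] is a map of points
    over [N] with bijective restriction to the kernels. *)
Lemma central_division (N V : X) (R : Graph N) (v : Hom V N)
    (psi : Hom (prod V N) N) :
  equivalence_relation R -> is_normalisation R v ->
  (forall T (w : Hom T V), psi ∘ pair w (zero T N) = v ∘ w) ->
  (forall T (y : Hom T N), psi ∘ pair (zero T V) y = y) ->
  (forall T (x y : Hom T N), related R x y ->
     exists d : Hom T V, psi ∘ pair d y = x) /\
  (forall T (d d' : Hom T V) (y : Hom T N),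
     psi ∘ pair d y = psi ∘ pair d' y -> d = d').
Proof.
  intros [HRm HR] Hv Hpsi1 Hpsi2. apply (normalisation_iff _ HRm) in Hv as [vm Hv].
  assert (Hrel : related R psi (pr2 V N)).
  { rewrite <- (comp_id_r psi), <- (comp_id_r (pr2 V N)).
    apply (@product_generated V N (fun T a => related R (psi ∘ a) (pr2 V N ∘ a))).
    - now apply representable_related.
    - rewrite Hpsi1, pr2_pair, comp_id_r. apply (equiv_sym _ _ (HR V)), Hv.
      exists (idm V). apply comp_id_r.
    - intros T y. rewrite Hpsi2, pr2_pair. apply (equiv_refl _ _ (HR T)). }
  destruct Hrel as [h [h1 h2]].
  assert (Hiso : is_iso h).
  { destruct (reflexivity_map (conj HRm HR)) as (r & r1 & r2).
    apply (@point_map_iso (prod V N) (gr_ob R) N (pr2 V N)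
      (pair (zero N V) (idm N)) (gr2 R) r).
    - apply pr2_pair.
    - exact r2.
    - exact h2.
    - apply HRm.
      + now rewrite (reassoc h1), Hpsi2.
      + now rewrite (reassoc h2), pr2_pair.
    - intros T a ea.
      destruct (proj1 (Hv T (gr1 R ∘ a))) as [w Hw].
      { apply (equiv_sym _ _ (HR T)). now exists a. }
      exists (pair w (zero T N)). split; [apply pr2_pair|]. apply HRm.
      + now rewrite (reassoc h1), Hpsi1.
      + now rewrite (reassoc h2), pr2_pair.
    - intros T a b ea eb e. apply (f_equal (comp (gr1 R))) in e.
      rewrite !(reassoc h1), <- (pair_eta a), <- (pair_eta b), ea, eb in e.
      rewrite !Hpsi1 in e. apply vm in e.
      now rewrite <- (pair_eta a), <- (pair_eta b), ea, eb, e. }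
  destruct Hiso as [g [gh hg]]. split.
  - intros T x y [a [a1 a2]]. exists (pr1 V N ∘ (g ∘ a)).
    rewrite <- h1, <- a1, <- comp_assoc. f_equal.
    assert (e : pr2 V N ∘ (g ∘ a) = y).
    { now rewrite <- h2, <- comp_assoc, (comp_assoc h), hg, comp_id_l. }
    rewrite <- e, pair_eta, comp_assoc, hg. apply comp_id_l.
  - intros T d d' y e.
    assert (e' : h ∘ pair d y = h ∘ pair d' y).
    { apply HRm.
      - now rewrite !(reassoc h1).
      - now rewrite !(reassoc h2), !pr2_pair. }
    apply (f_equal (comp g)) in e'. rewrite !(reassoc gh), !comp_id_l in e'.
    apply (f_equal (comp (pr1 V N))) in e'. now rewrite !pr1_pair in e'.
Qed.

(** Over the zero object every object is a point in a unique way. *)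
Lemma centralise_over_zero (D : Points Z) (G H : Graph D) :
  centralise (pt_graph G) (pt_graph H) -> centralise G H.
Proof.
  assert (Hex : forall (C C' : Points Z) (h : Hom (pt_ob C) (pt_ob C')),
    exists h' : Hom C C', pt_arrow h' = h).
  { intros C C' h. apply pt_hom_exists; [apply to0_unique | apply from0_unique]. }
  intros (P & p & q & theta & Hpb & H1 & H2).
  set (P' := {| pt_ob := P; pt_map := to0 Z P; pt_sec := from0 Z P;
                pt_split := to0_unique _ _ |} : Points Z).
  destruct (Hex P' (gr_ob G) p) as [p' <-].
  destruct (Hex P' (gr_ob H) q) as [q' <-].
  destruct (Hex P' D theta) as [t' <-].
  exists P', p', q', t'. split; [split|split].
  - apply pt_arrow_inj, Hpb.
  - intros T x y e. apply (f_equal (@pt_arrow _ _ _)) in e.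
    destruct (proj2 Hpb _ _ _ e) as [u [[pu qu] Hu]].
    destruct (Hex T P' u) as [u' <-]. exists u'. split.
    + split; now apply pt_arrow_inj.
    + intros w [<- <-]. apply pt_arrow_inj, Hu. now split.
  - intros T u e. apply pt_arrow_inj, H1. exact (f_equal (@pt_arrow _ _ _) e).
  - intros T u e. apply pt_arrow_inj, H2. exact (f_equal (@pt_arrow _ _ _) e).
Qed.

(** Fixed throughout are two equivalence relations whose normalisations [M] and
    [N] commute, with cooperator [phi]. *)
Section CommutingNormalisations.
Variables (A : X) (R S : Graph A).
Hypotheses (HR : equivalence_relation R) (HS : equivalence_relation S).
Variables (M N : X) (m : Hom M A) (n : Hom N A).
Hypotheses (Hm : is_normalisation R m) (Hn : is_normalisation S n).
Variable phi : Hom (prod M N) A.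
Hypothesis Hphi1 : forall T (x : Hom T M), phi ∘ pair x (zero T N) = m ∘ x.
Hypothesis Hphi2 : forall T (y : Hom T N), phi ∘ pair (zero T M) y = n ∘ y.

(** Modulo [R] the elements of [M] are zero, so [phi(x, y)] is [y]. *)
Lemma cooperator_related_right (T : X) (x : Hom T M) (y : Hom T N) :
  related R (phi ∘ pair x y) (n ∘ y).
Proof.
  assert (Hrel : related R (phi ∘ pair x y) ((n ∘ pr2 M N) ∘ pair x y)).
  { apply (@product_generated M N
      (fun T a => related R (phi ∘ a) ((n ∘ pr2 M N) ∘ a))).
    - apply representable_related, HR.
    - rewrite Hphi1, <- comp_assoc, pr2_pair, zero_r, comp_id_r.
      apply (equiv_sym _ _ (proj2 HR M)).
      apply (normalisation_iff m (proj1 HR)); [exact Hm|].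
      exists (idm M). apply comp_id_r.
    - intros T' y'. rewrite Hphi2, <- comp_assoc, pr2_pair.
      apply (equiv_refl _ _ (proj2 HR T')). }
  now rewrite <- comp_assoc, pr2_pair in Hrel.
Qed.

(** Modulo [S] the elements of [N] are zero, so [phi(x, y)] is [x]. *)
Lemma cooperator_related_left (T : X) (x : Hom T M) (y : Hom T N) :
  related S (m ∘ x) (phi ∘ pair x y).
Proof.
  assert (Hrel : related S ((m ∘ pr1 M N) ∘ pair x y) (phi ∘ pair x y)).
  { apply (@product_generated M N
      (fun T a => related S ((m ∘ pr1 M N) ∘ a) (phi ∘ a))).
    - apply representable_related, HS.
    - rewrite Hphi1, <- comp_assoc, pr1_pair, comp_id_r.
      apply (equiv_refl _ _ (proj2 HS M)).
    - intros T' y'. rewrite Hphi2, <- comp_assoc, pr1_pair, zero_r.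
      apply (normalisation_iff n (proj1 HS)); [exact Hn|]. now exists y'. }
  now rewrite <- comp_assoc, pr1_pair in Hrel.
Qed.

(** [K] is the object of pairs [(y, z)] with [0 R y] and [y S z], that is, the
    kernel of the point of triples. *)
Section Coordinates.
Variables (K : X) (k2 k3 : Hom K A).
Hypothesis Krel : related R (zero K A) k2 /\ related S k2 k3.
Hypothesis Klift : forall T (y z : Hom T A),
  related R (zero T A) y -> related S y z ->
  exists t : Hom T K, k2 ∘ t = y /\ k3 ∘ t = z.
Hypothesis Kext : forall T (t t' : Hom T K),
  k2 ∘ t = k2 ∘ t' -> k3 ∘ t = k3 ∘ t' -> t = t'.

(** The morphism [(x, y) |-> (x, phi(x, y))] from [M × N] to [K] is a map of points
    over [M]. On both sides the kernel is [N], so it is invertible, and [kap], [lam]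
    are the components of the inverse. *)
Lemma product_coordinates :
  exists (kap : Hom K M) (lam : Hom K N), m ∘ kap = k2 /\ phi ∘ pair kap lam = k3.
Proof.
  destruct (proj1 (normalisation_iff m (proj1 HR)) Hm) as [mm Hm'].
  destruct (proj1 (normalisation_iff n (proj1 HS)) Hn) as [nm Hn'].
  destruct (proj1 (Hm' K k2) (proj1 Krel)) as [kap Hkap].
  destruct (@Klift (prod M N) (m ∘ pr1 M N) phi) as [h [h2 h3]].
  { apply Hm'. now exists (pr1 M N). }
  { assert (e := pair_eta (idm (prod M N))). rewrite !comp_id_r in e.
    rewrite <- (comp_id_r phi), <- e. apply cooperator_related_left. }
  assert (kh : kap ∘ h = pr1 M N)
    by (apply mm; now rewrite (reassoc Hkap), h2).
  assert (Hiso : is_iso h).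
  { apply (@point_map_iso (prod M N) K M (pr1 M N) (pair (idm M) (zero M N)) kap
      (h ∘ pair (idm M) (zero M N))).
    - apply pr1_pair.
    - now rewrite (reassoc kh), pr1_pair.
    - exact kh.
    - reflexivity.
    - intros T d ed.
      assert (e2 : k2 ∘ d = zero T A) by (now rewrite <- Hkap, <- comp_assoc, ed, zero_r).
      assert (Hs := related_comp d (proj2 Krel)). rewrite e2 in Hs.
      apply Hn' in Hs as [y Hy].
      exists (pair (zero T M) y). split; [apply pr1_pair|]. apply Kext.
      + now rewrite (reassoc h2), <- comp_assoc, pr1_pair, zero_r, e2.
      + now rewrite (reassoc h3), Hphi2.
    - intros T a b ea eb e. apply (f_equal (comp k3)) in e.
      rewrite !(reassoc h3), <- (pair_eta a), <- (pair_eta b), ea, eb, !Hphi2 in e.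
      apply nm in e. now rewrite <- (pair_eta a), <- (pair_eta b), ea, eb, e. }
  destruct Hiso as [g [_ hg]].
  exists kap, (pr2 M N ∘ g). split; [exact Hkap|].
  assert (e : kap = pr1 M N ∘ g)
    by (now rewrite <- kh, <- comp_assoc, hg, comp_id_r).
  now rewrite e, pair_eta, <- h3, <- comp_assoc, hg, comp_id_r.
Qed.

(** In the coordinates [M × N] of [K], elements related by [H] have the same first
    coordinate, and elements related by [G] have [R]-related second coordinates.
    On [N] differences of [R]-related elements exist, so the centraliser is
    [((k, l), (k', l'), (k', l'')) |-> (k, (l - l') + l'')]. *)
Lemma kernel_centralise (G H : Graph K) :
  (forall T (t t' : Hom T K), related G t t' -> related R (k3 ∘ t) (k3 ∘ t')) ->
  (forall T (t t' : Hom T K), related H t t' -> k2 ∘ t = k2 ∘ t') ->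
  centralise G H.
Proof.
  intros HG HH.
  destruct (proj1 (normalisation_iff m (proj1 HR)) Hm) as [mm Hm'].
  destruct (proj1 (normalisation_iff n (proj1 HS)) Hn) as [nm Hn'].
  destruct product_coordinates as (kap & lam & Hkap & Hlam).
  (* [RN] is the restriction of [R] to [N]. *)
  destruct (@graph_of_representable N (fun T a =>
    related R ((n ∘ pr1 N N) ∘ a) ((n ∘ pr2 N N) ∘ a))) as (RN & HRN & HRNrel).
  { apply representable_related, HR. }
  assert (HRNrel' : forall T (x y : Hom T N), related RN x y <-> related R (n ∘ x) (n ∘ y)).
  { intros T x y. rewrite HRNrel, <- !comp_assoc, pr1_pair, pr2_pair. reflexivity. }
  assert (HRNeq : equivalence_relation RN).
  { split; [exact HRN|]. intro T. constructor.
    - intro x. apply HRNrel', (equiv_refl _ _ (proj2 HR T)).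
    - intros x y z' Hxy Hyz. apply HRNrel' in Hxy, Hyz. apply HRNrel'.
      exact (equiv_trans _ _ (proj2 HR T) _ _ _ Hxy Hyz).
    - intros x y Hxy. apply HRNrel' in Hxy. apply HRNrel'.
      exact (equiv_sym _ _ (proj2 HR T) _ _ Hxy). }
  destruct (normalisation_exists HRN) as (V & v & Hv).
  destruct (proj1 (normalisation_iff v HRN) Hv) as [vm Hv'].
  (* [V] is the intersection of [M] and [N], with inclusions [mu] and [v]; the
     restriction [psi] of [phi] to it takes its values in [N]. *)
  destruct (proj1 (Hm' V (n ∘ v))) as [mu Hmu].
  { rewrite <- (zero_r V n). apply HRNrel', Hv'.
    exists (idm V). apply comp_id_r. }
  destruct (proj1 (Hn' (prod V N) (phi ∘ pair (mu ∘ pr1 V N) (pr2 V N))))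
    as [psi Hpsi].
  { apply (equiv_trans _ _ (proj2 HS _)) with (m ∘ (mu ∘ pr1 V N)).
    - rewrite (reassoc Hmu), <- comp_assoc. apply Hn'. now exists (v ∘ pr1 V N).
    - apply cooperator_related_left. }
  assert (Hpsi1 : forall T (w : Hom T V), psi ∘ pair w (zero T N) = v ∘ w).
  { intros T w. apply nm.
    rewrite (reassoc Hpsi), <- comp_assoc, pair_comp, <- comp_assoc, pr1_pair, pr2_pair.
    now rewrite Hphi1, (reassoc Hmu), <- comp_assoc. }
  assert (Hpsi2 : forall T (y : Hom T N), psi ∘ pair (zero T V) y = y).
  { intros T y. apply nm.
    rewrite (reassoc Hpsi), <- comp_assoc, pair_comp, <- comp_assoc, pr1_pair, pr2_pair.
    now rewrite zero_r, Hphi2. }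
  destruct (central_division HRNeq Hv Hpsi1 Hpsi2) as [Hdiv Huniq].
  assert (lamR : forall T (x : Hom T K), related R (k3 ∘ x) (n ∘ (lam ∘ x))).
  { intros T x. rewrite <- Hlam, <- comp_assoc, pair_comp.
    apply cooperator_related_right. }
  set (P := fc_pullback L (gr2 G) (gr1 H)).
  set (t := gr1 G ∘ pb1 P). set (t' := gr2 G ∘ pb1 P). set (t'' := gr2 H ∘ pb2 P).
  assert (Et' : t' = gr1 H ∘ pb2 P) by apply pb_square.
  assert (Hk2 : k2 ∘ t' = k2 ∘ t'').
  { apply HH. rewrite Et'. now exists (pb2 P). }
  assert (Hk3 : related R (k3 ∘ t) (k3 ∘ t')).
  { apply HG. now exists (pb1 P). }
  (* [t], [t'], [t''] is the universal triple, and [d] is the difference of the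
     second coordinates of [t] and [t']. *)
  destruct (Hdiv _ (lam ∘ t) (lam ∘ t')) as [d Hd].
  { apply HRNrel'.
    apply (equiv_trans _ _ (proj2 HR _)) with (k3 ∘ t).
    { apply (equiv_sym _ _ (proj2 HR _)), lamR. }
    apply (equiv_trans _ _ (proj2 HR _)) with (k3 ∘ t'); [exact Hk3 | apply lamR]. }
  destruct (@Klift (pb P) (m ∘ (kap ∘ t))
    (phi ∘ pair (kap ∘ t) (psi ∘ pair d (lam ∘ t'')))) as [theta [th2 th3]].
  { apply Hm'. now exists (kap ∘ t). }
  { apply cooperator_related_left. }
  exists (pb P), (pb1 P), (pb2 P), theta.
  split; [apply Pullback_is_pullback|split]; intros T u e.
  - rewrite !comp_assoc in e. fold t'' in e. rewrite <- Et' in e.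
    rewrite (comp_assoc (gr1 G)). fold t. apply Kext.
    + now rewrite (reassoc th2), (reassoc Hkap), <- comp_assoc.
    + rewrite (reassoc th3), <- comp_assoc, pair_comp, <- (comp_assoc psi), pair_comp.
      rewrite <- (comp_assoc lam t''), <- e, (comp_assoc lam t'), <- pair_comp.
      rewrite (reassoc Hd), <- pair_comp, <- pair_comp.
      now rewrite !comp_assoc, Hlam.
  - rewrite !comp_assoc in e. fold t t' in e.
    rewrite (comp_assoc (gr2 H)). fold t''.
    assert (e2 : k2 ∘ (t ∘ u) = k2 ∘ (t'' ∘ u)).
    { rewrite e, !comp_assoc. now rewrite Hk2. }
    assert (ekap : kap ∘ (t ∘ u) = kap ∘ (t'' ∘ u)).
    { apply mm. now rewrite !(reassoc Hkap). }
    assert (ed : d ∘ u = zero T V).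
    { apply (Huniq _ _ _ (lam ∘ t' ∘ u)).
      now rewrite Hpsi2, <- pair_comp, (reassoc Hd), <- !comp_assoc, e. }
    apply Kext.
    + now rewrite (reassoc th2), (reassoc Hkap), <- comp_assoc.
    + rewrite (reassoc th3), <- comp_assoc, pair_comp, <- (comp_assoc psi), pair_comp.
      rewrite ed, Hpsi2, <- !comp_assoc, ekap, <- pair_comp, comp_assoc.
      now rewrite Hlam.
Qed.

End Coordinates.
End CommutingNormalisations.

(** For the point of triples, [G] is the relation [z R z'] and [H] the relation
    [y = y'], both within the fibres. They centralise each other on the kernel by
    [kernel_centralise], hence over [A]. For [x R y S z] the triples
    [(y, x, x)], [(y, y, y)], [(y, y, z)] lie over [y], the first two being related
    by [G] and the last two by [H]; the last component of the value of their
    centraliser is [theta(x, y, z)]. *)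
Lemma smith_is_huq_of_C_bar : condition_C_bar L -> smith_is_huq X.
Proof.
  intros C A R S HR HS M N m n Hm Hn Hmn.
  apply huq_commute_iff in Hmn as (phi & Hphi1 & Hphi2).
  destruct (triple_point HR HS) as (D & t2 & t3 & Drel & Dlift & Dext).
  destruct (fibrewise_inverse_image t3 HR) as (G & HG & Grel).
  destruct (fibrewise_inverse_image t2 (discrete_equivalence A))
    as (H & HH & Hrel).
  set (p := from0 Z A).
  assert (Hc : centralise G H).
  { apply (C _ _ p _ _ _ HG HH). apply centralise_over_zero.
    set (pi := pt_proj p D).
    assert (mpi : pt_map D ∘ pi = zero _ _).
    { exact (eq_trans (eq_sym (pb_square (fc_pullback L p (pt_map D))))
        (from0_zero _ _)). }
    refine (@kernel_centralise A R S HR HS M N m n Hm Hn phi Hphi1 Hphi2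
      (pt_ob (point_pullback L p D)) (t2 ∘ pi) (t3 ∘ pi) _ _ _ _ _ _ _).
    - rewrite <- mpi. apply Drel.
    - intros T y z' Hy Hz. destruct (Dlift T _ _ _ Hy Hz) as (t & e1 & e2 & e3).
      destruct (@pt_pullback_lift _ _ p D T (to0 Z T) t) as (a & a1 & a2).
      { rewrite e1. reflexivity. }
      exists a. rewrite <- !comp_assoc. fold pi in a2. now rewrite a2, e2, e3.
    - intros T x y e2 e3. rewrite <- !comp_assoc in e2, e3.
      apply pt_pullback_ext; [apply to0_unique|]. apply Dext; [|exact e2|exact e3].
      fold pi. now rewrite !(reassoc mpi), !zero_l.
    - intros T x y [a [<- <-]]. rewrite <- !comp_assoc.
      apply (Grel T). exists (pt_proj p (gr_ob G) ∘ a).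
      split; symmetry; apply pt_proj_hom.
    - intros T x y [a [<- <-]]. rewrite <- !comp_assoc.
      apply discrete_related, (Hrel T). exists (pt_proj p (gr_ob H) ∘ a).
      split; symmetry; apply pt_proj_hom. }
  apply slice_centralise_of_points in Hc.
  destruct Hc as (P & a & b & theta & Hpb & H1 & H2).
  set (Q := fc_pullback L (gr2 R) (gr1 S)).
  set (y := gr2 R ∘ pb1 Q).
  assert (Ey : y = gr1 S ∘ pb2 Q) by apply pb_square.
  assert (Rxy : related R (gr1 R ∘ pb1 Q) y) by (now exists (pb1 Q)).
  assert (Syz : related S y (gr2 S ∘ pb2 Q)) by (rewrite Ey; now exists (pb2 Q)).
  assert (Ryx := equiv_sym _ _ (proj2 HR _) _ _ Rxy).
  assert (Ryy := equiv_refl _ _ (proj2 HR _) y).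
  assert (Sxx := equiv_refl _ _ (proj2 HS _) (gr1 R ∘ pb1 Q)).
  assert (Syy := equiv_refl _ _ (proj2 HS _) y).
  destruct (Dlift _ _ _ _ Ryx Sxx) as (d & d1 & d2 & d3).
  destruct (Dlift _ _ _ _ Ryy Syy) as (d' & d'1 & d'2 & d'3).
  destruct (Dlift _ _ _ _ Ryy Syz) as (d'' & d''1 & d''2 & d''3).
  destruct (proj2 (Grel _ d d')) as [c [c1 c2]].
  { rewrite d1, d'1, d3, d'3. now split. }
  destruct (proj2 (Hrel _ d' d'')) as [c' [c'1 c'2]].
  { rewrite d'1, d''1, d'2, d''2, discrete_related. now split. }
  (* Elements of [Q] are viewed over [A] through their middle component [y]. *)
  set (O := fun T (v : Hom T (pb Q)) => {| sl_ob := T; sl_map := y ∘ v |} : Slice A).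
  assert (ec : pt_map (gr_ob G) ∘ c = y ∘ idm _).
  { rewrite <- (pt_arrow_map_comp (gr1 G)), comp_id_r, <- d1, <- c1. reflexivity. }
  assert (ec' : pt_map (gr_ob H) ∘ c' = y ∘ idm _).
  { rewrite <- (pt_arrow_map_comp (gr1 H)), comp_id_r, <- d'1, <- c'1. reflexivity. }
  set (sc := exist _ c ec : Hom (O _ (idm _)) (slice_of_point (gr_ob G))).
  set (sc' := exist _ c' ec' : Hom (O _ (idm _)) (slice_of_point (gr_ob H))).
  destruct (proj2 Hpb _ sc sc') as [u [[au bu] _]].
  { apply sig_ext. exact (eq_trans c2 (eq_sym c'1)). }
  exists (pb Q), (pb1 Q), (pb2 Q), (t3 ∘ (proj1_sig theta ∘ proj1_sig u)).
  assert (eO : forall T (v : Hom T (pb Q)),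
    sl_map (O _ (idm _)) ∘ v = sl_map (O T v)) by (intros; simpl; now rewrite comp_id_r).
  split; [apply Pullback_is_pullback|split]; intros T v e.
  - set (v' := exist _ v (eO T v) : Hom (O T v) (O _ (idm _))).
    assert (e1 : theta ∘ (u ∘ v') = gr1 (slice_graph_of_points G) ∘ (sc ∘ v')).
    { rewrite H1, (reassoc au); [reflexivity|]. rewrite (reassoc bu).
      apply sig_ext. change (gr1 (pt_graph H) ∘ (c' ∘ v) = gr2 (pt_graph H) ∘ (c' ∘ v)).
      rewrite (reassoc c'1), (reassoc c'2). apply Dext.
      - now rewrite (reassoc d'1), (reassoc d''1).
      - now rewrite (reassoc d'2), (reassoc d''2).
      - now rewrite (reassoc d'3), (reassoc d''3), Ey, <- !comp_assoc. }
    apply (f_equal (@proj1_sig _ _)) in e1.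
    change (proj1_sig theta ∘ (proj1_sig u ∘ v) = gr1 (pt_graph G) ∘ (c ∘ v)) in e1.
    rewrite <- !comp_assoc, e1, (reassoc c1), (reassoc d3), comp_assoc. reflexivity.
  - set (v' := exist _ v (eO T v) : Hom (O T v) (O _ (idm _))).
    assert (e1 : theta ∘ (u ∘ v') = gr2 (slice_graph_of_points H) ∘ (sc' ∘ v')).
    { rewrite H2, (reassoc bu); [reflexivity|]. rewrite (reassoc au).
      apply sig_ext. change (gr1 (pt_graph G) ∘ (c ∘ v) = gr2 (pt_graph G) ∘ (c ∘ v)).
      rewrite (reassoc c1), (reassoc c2). apply Dext.
      - now rewrite (reassoc d1), (reassoc d'1).
      - unfold y in d'2. now rewrite (reassoc d2), (reassoc d'2), <- !comp_assoc.
      - unfold y in d'3. now rewrite (reassoc d3), (reassoc d'3), <- !comp_assoc. }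
    apply (f_equal (@proj1_sig _ _)) in e1.
    change (proj1_sig theta ∘ (proj1_sig u ∘ v) = gr2 (pt_graph H) ∘ (c' ∘ v)) in e1.
    rewrite <- !comp_assoc, e1, (reassoc c'2), (reassoc d''3), comp_assoc. reflexivity.
Qed.

End FiniteLimits.

Theorem theorem1p1 (X : Category) (L : FinitelyComplete X)
    (HX : semi_abelian L) :
  (smith_is_huq X <-> condition_C L) /\
  (condition_C L <-> condition_C_bar L) /\
  (condition_C_bar L <-> basic_fibration_condition L).
Proof.
  destruct HX as (Hpt & _ & HP & HC).
  destruct (zero_data_of_pointed Hpt) as [Z].
  pose proof (C_of_smith_is_huq Z HP HC) as H12.
  pose proof (smith_is_huq_of_C Z HP HC) as H21.
  pose proof (basic_of_smith_is_huq Z HP) as H14.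
  pose proof (C_bar_of_basic HC (L := L)) as H43.
  pose proof (smith_is_huq_of_C_bar Z HP HC) as H31.
  tauto.
Qed.
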